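(* For every $\alpha > 1$ and every balance parameter $\omega > 0$ there is a randomized algorithm which, given a positive integer $k$ and any set $X$ of $n$ points in $\mathbb{R}^d$, finds \emph{exactly} a clustering of least $k$-means cost among all $k$-clusterings of $X$ that satisfy $\alpha$-center proximity and are balanced, i.e. every cluster has size at least $\omega n/k$. The algorithm succeeds with constant probability and runs in time $O\big(2^{\mathrm{poly}(k/(\omega(\alpha-1)))}\, n d\big)$.
   Context: A $k$-clustering of a finite set $X \subset \mathbb{R}^d$ is a partition $C_1,\dots,C_k$ of $X$ into nonempty sets; $\mu_i = \frac{1}{|C_i|}\sum_{x \in C_i} x$ denotes the mean of $C_i$. Its $k$-means cost is $\sum_{i=1}^k \sum_{x \in C_i} \|x-\mu_i\|^2$, with $\|\cdot\|$ the Euclidean norm. The clustering satisfies $\alpha$-center proximity (is $\alpha$-center proximal) if for all $i \neq j$ and all $x \in C_i$ we have $\|x - \mu_j\| > \alpha \|x - \mu_i\|$. *)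

(* Defs.v *)
From mathcomp Require Import all_boot all_order all_algebra.
From mathcomp Require Import reals exp.

Set Implicit Arguments.
Unset Strict Implicit.
Unset Printing Implicit Defensive.

Import Order.TTheory GRing.Theory Num.Theory.
Local Open Scope ring_scope.

(* A finite set of n points of R^d is an injective family X : 'I_n -> 'rV_d;
   a cluster is a set of indices, a clustering a set of clusters. *)
Section Clustering.
Variables (R : realType) (n d : nat).
Implicit Types (X : 'I_n -> 'rV[R]_d) (C : {set 'I_n}) (P : {set {set 'I_n}}).

(* The canonical norm of MathComp-Analysis on 'rV_d is the sup norm. *)
Definition enorm (v : 'rV[R]_d) : R := Num.sqrt (\sum_j v 0 j ^+ 2).

Definition mean X C : 'rV[R]_d := #|C|%:R^-1 *: \sum_(i in C) X i.

(* The MathComp predicate partition includes nonemptiness of the blocks. *)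
Definition is_clustering (k : nat) P : bool :=
  partition P [set: 'I_n] && (#|P| == k).

Definition kmeans_cost X P : R :=
  \sum_(C in P) \sum_(i in C) enorm (X i - mean X C) ^+ 2.

Definition center_proximal (alpha : R) X P : bool :=
  [forall A in P, forall B in P, (A != B) ==>
    [forall i in A, alpha * enorm (X i - mean X A) < enorm (X i - mean X B)]].

Definition balanced (omega : R) (k : nat) P : bool :=
  [forall C in P, omega * n%:R / k%:R <= #|C|%:R].

Definition admissible (alpha omega : R) (k : nat) X P : bool :=
  [&& is_clustering k P, center_proximal alpha X P & balanced omega k P].

Definition optimal (alpha omega : R) (k : nat) X P : bool :=
  admissible alpha omega k X P &&
  [forall Q : {set {set 'I_n}},
     admissible alpha omega k X Q ==> (kmeans_cost X P <= kmeans_cost X Q)].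

End Clustering.

(* Randomized algorithms are programs of a unit-cost real RAM: exact real
   arithmetic and comparisons but no rounding of a real to an integer, natural
   numbers for counters and addresses, uniform draws from {0, ..., m - 1}.
   There are two register files (naturals, reals), named by program text, and
   two memories, reached only through an address held in a natural register. *)
Section RealRAM.
Variable R : realType.

Record state := State {
  nreg : nat -> nat;
  rreg : nat -> R;
  nmem : nat -> nat;
  rmem : nat -> R }.

Definition set_nreg (s : state) (a v : nat) :=
  State [eta nreg s with a |-> v] (rreg s) (nmem s) (rmem s).
Definition set_rreg (s : state) (a : nat) (v : R) :=
  State (nreg s) [eta rreg s with a |-> v] (nmem s) (rmem s).
Definition set_nmem (s : state) (a v : nat) :=
  State (nreg s) (rreg s) [eta nmem s with a |-> v] (rmem s).
Definition set_rmem (s : state) (a : nat) (v : R) :=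
  State (nreg s) (rreg s) (nmem s) [eta rmem s with a |-> v].

(* In every instruction the first argument names the destination, except in
   the two stores, where it names the register holding the target address. *)
Inductive instr :=
  | NConst (a v : nat)
  | NAdd (a b c : nat)
  | NSub (a b c : nat)
  | NMul (a b c : nat)
  | NLoad (a b : nat)
  | NStore (a b : nat)
  | RConst (a : nat) (v : R)
  | RAdd (a b c : nat)
  | RSub (a b c : nat)
  | RMul (a b c : nat)
  | RDiv (a b c : nat)
  | ROfNat (a b : nat)
  | RLoad (a b : nat)
  | RStore (a b : nat).

Definition exec (o : instr) (s : state) : state :=
  match o with
  | NConst a v => set_nreg s a v
  | NAdd a b c => set_nreg s a (nreg s b + nreg s c)%N
  | NSub a b c => set_nreg s a (nreg s b - nreg s c)%N
  | NMul a b c => set_nreg s a (nreg s b * nreg s c)%N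
  | NLoad a b => set_nreg s a (nmem s (nreg s b))
  | NStore a b => set_nmem s (nreg s a) (nreg s b)
  | RConst a v => set_rreg s a v
  | RAdd a b c => set_rreg s a (rreg s b + rreg s c)
  | RSub a b c => set_rreg s a (rreg s b - rreg s c)
  | RMul a b c => set_rreg s a (rreg s b * rreg s c)
  | RDiv a b c => set_rreg s a (rreg s b / rreg s c)
  | ROfNat a b => set_rreg s a (nreg s b)%:R
  | RLoad a b => set_rreg s a (rmem s (nreg s b))
  | RStore a b => set_rmem s (nreg s a) (rreg s b)
  end.

Inductive test :=
  | NLt (a b : nat)
  | RLt (a b : nat).

Definition holds (t : test) (s : state) : bool :=
  match t with
  | NLt a b => (nreg s a < nreg s b)%N
  | RLt a b => rreg s a < rreg s b
  end.

Inductive program :=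
  | Skip
  | Op (o : instr)
  | Draw (a b : nat)
  | Seq (p q : program)
  | If (t : test) (p q : program)
  | While (t : test) (p : program).

(* Probability that the programs in the list ps, run one after the other from
   s, terminate within T steps in a state satisfying E.  Each instruction,
   draw, test and control transfer is one step.  Draw a b puts a uniform
   element of {0, ..., m - 1} in a, where m is the content of b; a draw with
   m = 0 aborts, hence counts as non-termination. *)
Fixpoint halt_prob (T : nat) (ps : seq program) (s : state) (E : pred state)
    : R :=
  if ps is p :: qs then
    if T is T'.+1 then
      match p with
      | Skip => halt_prob T' qs s E
      | Op o => halt_prob T' qs (exec o s) E
      | Draw a b =>
          (\sum_(i < nreg s b) halt_prob T' qs (set_nreg s a i) E)
            / (nreg s b)%:R
      | Seq p1 p2 => halt_prob T' [:: p1, p2 & qs] s E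
      | If t p1 p2 => halt_prob T' ((if holds t s then p1 else p2) :: qs) s E
      | While t p1 =>
          halt_prob T' (if holds t s then [:: p1, p & qs] else qs) s E
      end
    else 0
  else (E s)%:R.

(* n, d, k in natural registers 0, 1, 2 and the coordinates of the points, row
   by row, in the real memory; everything else is 0. *)
Definition input (n d k : nat) (X : 'I_n -> 'rV[R]_d) : state :=
  State (nth 0%N [:: n; d; k]) (fun=> 0) (fun=> 0%N)
    (nth 0 [seq X i 0 j | i <- enum 'I_n, j <- enum 'I_d]).

(* The natural memory holds one label per point; equal labels mean same
   cluster. *)
Definition output (n : nat) (s : state) : {set {set 'I_n}} :=
  preim_partition (fun i : 'I_n => nmem s i) [set: 'I_n].

End RealRAM.

(* Main.v *)
Require Import Defs.
From mathcomp Require Import all_boot all_order all_algebra.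
From mathcomp Require Import reals exp.
From mathcomp Require Import zify ring lra.

(* The program repeats a trial: for each of k clusters add up m uniformly drawn
   points, assign every point to the nearest of the k resulting sample means,
   compute the exact means of the clusters so obtained, check balance and
   proximity, and keep the cheapest clustering that passes.

   Put a = min(alpha, 2) and let P be an optimal clustering.  Proximity bounds
   the radius of a cluster of P by D / (a - 1), where D is the distance of its
   mean to any other mean.  Hence, if m >= 72 / (a - 1)^4 and all the draws for a
   cluster do fall into it, the sample mean is, with probability at least 1/2
   (Markov), within (a - 1) / 6 * D of the true mean; and centers that accurate
   still have P as their Voronoi partition, by the margin in the proximity
   condition.  By balance each draw hits its cluster with probability at least
   omega / k, so a trial finds P with probability at least
   ((omega / k)^m / 2)^k, and (2 (W k)^m)^k trials with W >= 1 / omega succeed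
   with probability at least 1/2.

   For omega > 1 no clustering is admissible and the program does nothing. *)

Set Implicit Arguments.
Unset Strict Implicit.
Unset Printing Implicit Defensive.

Import Order.TTheory GRing.Theory Num.Theory.
Local Open Scope ring_scope.

(** * A program logic for the real RAM *)

(** No measure theory is used: [halt_prob] is treated as an expectation transformer, and a triple
    pushes a lower bound for the expected final value backwards through the program. Independence of
    the draws is never stated; it appears as a product of factors picked up loop by loop. The values
    carried have the shape v0 + D * (indicator of success), a class closed under averaging and under
    repetition of trials.

    Errors are one-sided: a clustering is stored only after an exact check, so a bad sample never
    stores an inadmissible one, and a stored cost of at most the optimum certifies optimality.

    The cut-off at 2 in a = min(alpha, 2) keeps (a - 1) * (2 - a) nonnegative, which the Voronoi
    margin needs; proximity for alpha implies it for the smaller a. Square roots are avoided by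
    comparing squared distances with alpha^2. Both m and W depend on alpha and omega only, so one
    program text serves all inputs. *)

Section Logic.
Variable R : realType.
Implicit Types (s : state R) (p : program R) (ps qs : seq (program R)).
Implicit Types (t T : nat) (I Q : state R -> Prop) (g : state R -> R) (v : R).

Lemma halt_prob_ge0 T ps s E : 0 <= halt_prob T ps s E.
Proof.
elim: T ps s => [|T IH] [|p ps] s //=; try by rewrite ler0n.
case: p => [|o|a b|p q|c p q|c p] //=.
by rewrite divr_ge0 ?ler0n// sumr_ge0.
Qed.

Lemma halt_probS T ps s E : halt_prob T ps s E <= halt_prob T.+1 ps s E.
Proof.
elim: T ps s => [|T IH] [|p ps] s //; first exact: halt_prob_ge0.
case: p => [|o|a b|p q|c p q|c p]; try exact: IH.
rewrite /= ler_wpM2r ?invr_ge0 ?ler0n//.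
by apply: ler_sum => i _; exact: IH.
Qed.

(** This is what allows every routine to be given a crude, rounded-up time bound. *)
Lemma halt_prob_le T T' ps s E :
  (T <= T')%N -> halt_prob T ps s E <= halt_prob T' ps s E.
Proof.
move=> /subnK <-; elim: (_ - _)%N => // r IH.
exact: (le_trans IH (halt_probS _ _ _ _)).
Qed.

(* p, started in s, surely stops within t steps in a state satisfying I, and
   the expectation of g over the final state is at least v.  Quantifying over
   the continuation qs makes the sequencing rule immediate. *)
Definition trip t p s I g v :=
  forall T qs E, (forall s', I s' -> g s' <= halt_prob T qs s' E) ->
    v <= halt_prob (t + T) (p :: qs) s E.

(** Total correctness: an arbitrary constant value passes through, and [trip_of_ht] turns it into
    any expectation bounded below on [Q]. *)
Definition ht t p s Q := forall v, trip t p s Q (fun=> v) v.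

Lemma trip_of_ht t p s Q I g v :
  ht t p s Q -> (forall s', Q s' -> I s' /\ v <= g s') -> trip t p s I g v.
Proof.
move=> h QI T qs E H; apply: h => s' /QI[Is' vg].
exact: (le_trans vg (H _ Is')).
Qed.

Lemma trip_weak t p s I I' g g' v v' :
  trip t p s I' g' v' -> (forall s', I' s' -> I s' /\ g' s' <= g s') ->
  v <= v' -> trip t p s I g v.
Proof.
move=> h sub vv T qs E H; apply: (le_trans vv); apply: h => s' /sub[Is' gs'].
exact: (le_trans gs' (H _ Is')).
Qed.

Lemma trip_le t' t p s I g v : trip t' p s I g v -> (t' <= t)%N -> trip t p s I g v.
Proof.
move=> h tt T qs E H; apply: (le_trans (h T qs E H)).
by apply: halt_prob_le; rewrite leq_add2r.
Qed.

Lemma ht_le t' t p s Q : ht t' p s Q -> (t' <= t)%N -> ht t p s Q.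
Proof. by move=> h tt v; exact: (trip_le (h v)). Qed.

Lemma ht_weak t p s Q Q' : ht t p s Q' -> (forall s', Q' s' -> Q s') -> ht t p s Q.
Proof. by move=> h sub v; apply: (trip_of_ht h) => s' /sub. Qed.

Lemma trip_seq t1 t2 p1 p2 s I J h g v :
  trip t1 p1 s I h v -> (forall s', I s' -> trip t2 p2 s' J g (h s')) ->
  trip (t1 + t2).+1 (Seq p1 p2) s J g v.
Proof.
move=> h1 h2 T qs E H; rewrite addSn /= -addnA; apply: h1 => s' Is'.
exact: h2.
Qed.

Lemma ht_seq t1 t2 p1 p2 s I Q :
  ht t1 p1 s I -> (forall s', I s' -> ht t2 p2 s' Q) ->
  ht (t1 + t2).+1 (Seq p1 p2) s Q.
Proof. by move=> h1 h2 v; apply: trip_seq (h1 v) _ => s' Is'; exact: h2. Qed.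

Lemma ht_skip s Q : Q s -> ht 1 (Skip R) s Q.
Proof. by move=> Qs v T qs E H; exact: H. Qed.

(** Straight-line blocks stay folded, so that the state after them is one [foldl] computed by
    simplification. An instruction costs two steps, one of them for its [Seq]. *)
Definition ops (l : seq (instr R)) p := foldr (fun o => Seq (Op o)) p l.
Arguments ops : simpl never.

Lemma trip_ops t l p s I g v :
  trip t p (foldl (fun s o => exec o s) s l) I g v ->
  trip ((size l).*2 + t) (ops l p) s I g v.
Proof.
elim: l s => //= o l IH s /IH h T qs E H.
by rewrite /ops doubleS !addSn /=; exact: h.
Qed.

Lemma ht_ops t l p s Q :
  ht t p (foldl (fun s o => exec o s) s l) Q -> ht ((size l).*2 + t) (ops l p) s Q.
Proof. by move=> h v; apply: trip_ops. Qed.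

Lemma ht_if t c p q s Q :
  (holds c s -> ht t p s Q) -> (~~ holds c s -> ht t q s Q) -> ht t.+1 (If c p q) s Q.
Proof.
move=> hp hq v T qs E H; rewrite addSn /=.
by case: ifPn => [/hp|/hq] h; exact: h.
Qed.

Lemma trip_draw a b s I g v : (0 < nreg s b)%N ->
  (forall i, (i < nreg s b)%N -> I (set_nreg s a i)) ->
  v <= (\sum_(i < nreg s b) g (set_nreg s a i)) / (nreg s b)%:R ->
  trip 1 (Draw R a b) s I g v.
Proof.
move=> b0 Ib vg T qs E H; apply: (le_trans vg); rewrite /= ler_wpM2r ?invr_ge0 ?ler0n//.
by apply: ler_sum => i _; apply/H/Ib.
Qed.

Definition nframe (b : nat) s s' := forall a, (a < b)%N -> nreg s' a = nreg s a.
Definition rframe (b : nat) s s' := forall a, (a < b)%N -> rreg s' a = rreg s a.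

Lemma nframe_trans b c s1 s2 s3 : (b <= c)%N ->
  nframe b s1 s2 -> nframe c s2 s3 -> nframe b s1 s3.
Proof. by move=> bc h1 h2 a ab; rewrite h2 ?h1 // (leq_trans ab). Qed.

(* Register 3 is assumed to hold 1, the increment of every loop counter. *)
Definition For (i b : nat) p :=
  ops [:: NConst R i 0]
    (While (NLt i b) (Seq p (Op (NAdd R i i 3)))).

(** The value [g j] is what the rounds from [j] on still guarantee; invariant and value are taken
    after the increment. A round costs its body plus test, [Seq] and increment; the final 3 pay for
    the initialisation and the last test. *)
Lemma trip_for i b p s0 B tb (I : nat -> state R -> Prop) (g : nat -> state R -> R) :
  nreg s0 b = B -> nreg s0 3%N = 1%N -> (b < i)%N -> (3 < i)%N ->
  I 0%N (set_nreg s0 i 0) ->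
  (forall j s, (j < B)%N -> nframe i s0 s -> nreg s i = j -> I j s ->
     trip tb p s (fun s' => nframe i.+1 s s' /\ I j.+1 (set_nreg s' i j.+1))
       (fun s' => g j.+1 (set_nreg s' i j.+1)) (g j s)) ->
  trip (B * (tb + 3) + 3) (For i b p) s0 (fun s' => nframe i s0 s' /\ I B s')
    (g B) (g 0%N (set_nreg s0 i 0)).
Proof.
move=> sb s3 bi i3 I0 body; rewrite addnC addSnnS addSn.
apply: (@trip_ops (1 + B * (tb + 3)) [:: _]) => /=.
suff loop r j s : (j + r)%N = B -> nframe i s0 s -> nreg s i = j -> I j s ->
    trip (1 + r * (tb + 3)) (While (NLt i b) (Seq p (Op (NAdd R i i 3)))) s
      (fun s' => nframe i s0 s' /\ I B s') (g B) (g j s).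
  apply: loop => //=; rewrite ?eqxx //.
  by move=> a ai /=; rewrite ltn_eqF.
elim: r j s => [|r IH] j s jr fr sj Ij T qs E H /=.
  have jB : j = B by rewrite -jr addn0.
  rewrite jB in sj Ij *.
  by rewrite sj fr// sb ltnn add0n; apply: H.
have jB : (j < B)%N by lia.
rewrite sj fr// sb jB mulSn.
have -> : (tb + 3 + r * (tb + 3) + T = (tb + (1 + (1 + r * (tb + 3) + T))).+1)%N by lia.
rewrite /=; apply: (body j s) => // s' [fr' Ij'].
have -> : halt_prob (1 + (1 + r * (tb + 3) + T)) [:: Op (NAdd R i i 3), While
    (NLt i b) (Seq p (Op (NAdd R i i 3))) & qs] s' E =
  halt_prob (1 + r * (tb + 3) + T) (While (NLt i b) (Seq p (Op (NAdd R i i 3))) :: qs)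
    (set_nreg s' i j.+1) E.
  by rewrite add1n /= fr'// sj fr' ?fr ?s3 ?addn1 //; lia.
apply: (IH j.+1) => //; first by lia.
- move=> a ai /=; rewrite ltn_eqF// fr'; first exact: fr.
  by lia.
- by rewrite /= eqxx.
Qed.

Lemma ht_for i b p s0 B tb (I : nat -> state R -> Prop) :
  nreg s0 b = B -> nreg s0 3%N = 1%N -> (b < i)%N -> (3 < i)%N ->
  I 0%N (set_nreg s0 i 0) ->
  (forall j s, (j < B)%N -> nframe i s0 s -> nreg s i = j -> I j s ->
     ht tb p s (fun s' => nframe i.+1 s s' /\ I j.+1 (set_nreg s' i j.+1))) ->
  ht (B * (tb + 3) + 3) (For i b p) s0 (fun s' => nframe i s0 s' /\ I B s').
Proof.
move=> sb s3 bi i3 I0 body v.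
apply: (@trip_for i b p s0 B tb I (fun _ _ => v)) => // j s jB fr sj Ij.
exact: body.
Qed.

End Logic.
Arguments ops {R} l p : simpl never.

(** * The program *)

(* Natural registers: 0, 1, 2 = n, d, k; 3 = 1; 4 = m; 5 = number of trials;
   6 = base of the sums of sampled points, 7 = base of the sums of the current
   clusters, 8 = total size of both tables; 9 = base of the cluster sizes;
   10 = 0 (for moves); 12 = trial counter; 13 = 1 once a clustering is stored;
   20 = 0 as soon as a check fails.  Real registers: 0 = cost of the stored
   clustering, 1 = alpha^2, 2 = omega n / k, 3 = m, 4 = 0, 5 = current cost.
   The natural memory holds the stored labels at 0, the current labels at n and
   the cluster sizes at 2 n.  Nested code uses higher registers, so that it
   preserves those of the enclosing loops. *)
Section Code.
Variable R : realType.
Variables (m W : nat) (al2 om : R).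

Local Notation Skip := (Skip R).
Local Notation NConst := (NConst R).
Local Notation NAdd := (NAdd R).
Local Notation NMul := (NMul R).
Local Notation NLoad := (NLoad R).
Local Notation NStore := (NStore R).
Local Notation RAdd := (RAdd R).
Local Notation RSub := (RSub R).
Local Notation RMul := (RMul R).
Local Notation RDiv := (RDiv R).
Local Notation RLoad := (RLoad R).
Local Notation RStore := (RStore R).
Local Notation ROfNat := (ROfNat R).

(** Centres and means are stored as undivided sums. The divisor in real register 40 lets one routine
    serve both: m for sampled sums, the size for clusters. Natural registers 40 and 41 hold the row
    addresses. *)
Definition dist_code : program R := ops [:: RConst 41 0] (For 42 1
  (ops [:: NAdd 43 40 42; NAdd 44 41 42; RLoad 42 43; RLoad 43 44; RDiv 43 43 40;
           RSub 42 42 43; RMul 42 42 42; RAdd 41 41 42] Skip)).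

Definition add_code : program R := For 42 1
  (ops [:: NAdd 43 40 42; NAdd 44 41 42; RLoad 42 43; RLoad 43 44; RAdd 43 43 42;
           RStore 44 43] Skip).

Definition zero_code : program R :=
  Seq (For 15 8 (ops [:: NAdd 40 6 15; RConst 40 0; RStore 40 40] Skip))
      (For 15 2 (ops [:: NAdd 40 9 15; NStore 40 10] Skip)).

Definition sample_code : program R :=
  For 15 2 (ops [:: NMul 17 15 1; NAdd 17 17 6]
    (For 16 4 (Seq (Draw R 40 0) (ops [:: NMul 40 40 1; NAdd 41 17 10] add_code)))).

Definition nearest_code : program R :=
  For 16 2 (ops [:: NAdd 40 22 10; NMul 41 16 1; NAdd 41 6 41; RAdd 40 3 4]
    (Seq dist_code
      (If (RLt 41 6) (ops [:: RAdd 6 41 4; NAdd 21 16 10] Skip) Skip))).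

(** The running minimum is seeded with centre 0, so no infinite start value is needed. *)
Definition assign_code : program R :=
  For 15 0 (ops [:: NMul 22 15 1; NConst 21 0; NAdd 40 22 10; NAdd 41 6 10; RAdd 40 3 4]
    (Seq dist_code (ops [:: RAdd 6 41 4] (Seq nearest_code
      (ops [:: NAdd 23 0 15; NStore 23 21; NAdd 24 9 21; NLoad 25 24; NAdd 25 25 3;
               NStore 24 25; NAdd 40 22 10; NMul 41 21 1; NAdd 41 7 41] add_code))))).

Definition bad_code : program R := ops [:: NConst 20 0] Skip.

(** Labels are told apart by two strict comparisons. The size test is repeated for every point, at a
    cost dominated by the distance computation. *)
Definition prox_code : program R :=
  For 16 2 (ops [:: NAdd 24 9 16; NLoad 25 24; ROfNat 40 25; RAdd 8 40 4;
                    NAdd 40 22 10; NMul 41 16 1; NAdd 41 7 41]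
    (Seq dist_code (Seq (If (RLt 8 2) bad_code Skip)
      (If (NLt 16 21) (If (RLt 7 41) Skip bad_code)
        (If (NLt 21 16) (If (RLt 7 41) Skip bad_code) Skip))))).

Definition check_code : program R :=
  ops [:: NConst 20 1; RConst 5 0] (For 15 0
    (ops [:: NMul 22 15 1; NAdd 23 0 15; NLoad 21 23; NAdd 24 9 21; NLoad 25 24;
             ROfNat 40 25; NAdd 40 22 10; NMul 41 21 1; NAdd 41 7 41]
      (Seq dist_code (ops [:: RAdd 5 5 41; RMul 7 1 41] prox_code)))).

Definition copy_code : program R :=
  For 15 0 (ops [:: NAdd 40 0 15; NLoad 41 40; NStore 15 41] Skip).

(* If nothing is stored yet, the comparison is made to succeed by taking
   current cost + 1 as the cost to beat. *)
Definition update_code : program R :=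
  If (NLt 10 20)
    (Seq (If (NLt 13 3) (ops [:: ROfNat 40 3; RAdd 0 5 40] Skip) Skip)
         (If (RLt 5 0) (ops [:: NConst 13 1; RAdd 0 5 4] copy_code) Skip))
    Skip.

Definition trial_code : program R :=
  Seq zero_code (Seq sample_code (Seq assign_code (Seq check_code update_code))).

(** The number of trials depends on the input k, hence is computed at run time: register 11 holds W
    k and register 17 ends with (2 (W k)^m)^k. *)
Definition power_code : program R :=
  For 15 2 (ops [:: NAdd 17 17 17] (For 16 4 (ops [:: NMul 17 17 11] Skip))).

Definition init_nat_code : program R :=
  ops [:: NConst 3 1; NConst 4 m; NMul 6 0 1; NMul 8 2 1; NAdd 7 6 8; NAdd 8 8 8;
          NAdd 9 0 0; NConst 10 0; NConst 11 W; NMul 11 11 2; NConst 13 0; NConst 17 1]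
    Skip.

Definition init_real_code : program R :=
  ops [:: RConst 1 al2; RConst 2 om; ROfNat 40 0; RMul 2 2 40; ROfNat 40 2; RDiv 2 2 40;
          ROfNat 3 4; RConst 4 0] Skip.

Definition init_code : program R :=
  Seq init_nat_code (Seq init_real_code (Seq power_code (ops [:: NAdd 5 17 10] Skip))).

Definition main_code : program R := Seq init_code (For 12 5 trial_code).

End Code.

(** * Specification of the program *)

Section Specs.
Variable R : realType.
Variables (n d k m N : nat) (al2 bal : R) (x : nat -> R).
Hypotheses (n0 : (0 < n)%N) (d0 : (0 < d)%N) (k0 : (0 < k)%N).
Implicit Types s : state R.

Record nenv s : Prop := Nenv {
  ne0 : nreg s 0 = n; ne1 : nreg s 1 = d; ne2 : nreg s 2 = k; ne3 : nreg s 3 = 1%N;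
  ne4 : nreg s 4 = m; ne5 : nreg s 5 = N; ne6 : nreg s 6 = (n * d)%N;
  ne7 : nreg s 7 = (n * d + k * d)%N; ne8 : nreg s 8 = (k * d + k * d)%N;
  ne9 : nreg s 9 = (n + n)%N; ne10 : nreg s 10 = 0%N }.

Record renv s : Prop := Renv {
  re1 : rreg s 1 = al2; re2 : rreg s 2 = bal; re3 : rreg s 3 = m%:R; re4 : rreg s 4 = 0;
  rex : forall a, (a < n * d)%N -> rmem s a = x a }.

Lemma nenv_frame b s s' : (12 <= b)%N -> nframe b s s' -> nenv s -> nenv s'.
Proof.
move=> b12 fr [*]; split; rewrite fr //; exact: leq_trans b12.
Qed.

Definition sqdist (r : nat -> R) (a1 a2 : nat) (w : R) :=
  \sum_(j < d) (r (a1 + j)%N - r (a2 + j)%N / w) ^+ 2.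

Definition pure s s' :=
  [/\ nframe 40 s s', rframe 40 s s', rmem s' = rmem s & nmem s' = nmem s].

Lemma dist_spec s : nreg s 1 = d -> nreg s 3 = 1%N ->
  ht (25 * d) (dist_code R) s (fun s' => pure s s' /\
    rreg s' 41 = sqdist (rmem s) (nreg s 40) (nreg s 41) (rreg s 40)).
Proof.
move=> s1 s3.
pose I j s' := [/\ forall a, (a <= 40)%N -> rreg s' a = rreg s a,
  rmem s' = rmem s, nmem s' = nmem s &
  rreg s' 41 = \sum_(i < j) (rmem s (nreg s 40 + i)%N - rmem s (nreg s 41 + i)%N / rreg s 40) ^+ 2].
rewrite /dist_code /add_code; eapply ht_le.
  eapply ht_ops.
  eapply ht_weak.
    apply: (@ht_for _ _ _ _ _ d _ I) => //=.
      split=> //= [a ? |]; first by rewrite ltn_eqF.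
      by rewrite big_ord0.
    move=> j s1' jd fr s42 [r40 rm nm r41].
    eapply ht_ops; apply: ht_skip => /=; split.
      by move=> a a43 /=; rewrite !ltn_eqF //; lia.
    split => //=.
      by move=> a a40; rewrite !ltn_eqF ?r40//; lia.
    rewrite big_ord_recr /= -r41; congr (_ + _).
    by rewrite expr2 rm s42 r40// !fr.
  move=> s' [fr [r40 rm nm r41]]; split => //; split=> //.
    by move=> a a40; rewrite fr ?(ltn_trans a40).
  by move=> a a40; rewrite r40 // ltnW.
by rewrite /=; lia.
Qed.

(** The source row ends before the target row begins, so no coordinate is read after being
    overwritten. *)
Lemma add_spec s : nreg s 1 = d -> nreg s 3 = 1%N ->
  (nreg s 40 + d <= nreg s 41)%N ->
  ht (25 * d) (add_code R) s (fun s' =>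
    [/\ nframe 40 s s', rframe 40 s s', nmem s' = nmem s &
     forall a, rmem s' a = if (nreg s 41 <= a < nreg s 41 + d)%N
       then rmem s a + rmem s (nreg s 40 + (a - nreg s 41))%N else rmem s a]).
Proof.
move=> s1 s3 dis.
pose I j s' := [/\ rframe 40 s s', nmem s' = nmem s &
  forall a, rmem s' a = if (nreg s 41 <= a < nreg s 41 + j)%N
       then rmem s a + rmem s (nreg s 40 + (a - nreg s 41))%N else rmem s a].
rewrite /dist_code /add_code; eapply ht_le.
  eapply ht_weak.
    apply: (@ht_for _ _ _ _ _ d _ I) => //=.
      split=> //= a; by case: ifP => // ?; lia.
    move=> j s1' jd fr s42 [r40 nm rm].
    eapply ht_ops; apply: ht_skip => /=; split.
      by move=> a a43 /=; rewrite !ltn_eqF //; lia.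
    split => //=.
      by move=> a a40 /=; rewrite !ltn_eqF ?r40//; lia.
    move=> a; rewrite s42 !fr// !rm; case: (eqVneq a (nreg s 41 + j)%N) => [->|aj].
      rewrite ltnn andbF leq_addr ltn_add2l ltnS leqnn /= addKn.
      case: ifP => //; lia.
    by congr (if _ then _ else _); lia.
  move=> s' [fr [r40 nm rm]]; split => //.
  by move=> a a40; rewrite fr ?(ltn_trans a40).
by rewrite /=; lia.
Qed.


Lemma row_bound c : (c < k)%N -> (c * d + d <= k * d)%N.
Proof. by move=> ck; rewrite -mulSnr leq_mul2r ck orbT. Qed.

Lemma row_inj c c' j : (j < d)%N -> (c * d <= c' * d + j < c * d + d)%N = (c == c').
Proof.
move=> jd; case: (ltngtP c c') => [cc|cc|->].
- by have := leq_mul cc (leqnn d); rewrite mulSnr; lia.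
- by have := leq_mul cc (leqnn d); rewrite mulSnr; lia.
- by rewrite leq_addr ltn_add2l jd.
Qed.

(** Address of row [c] in the table of sampled sums; [acc] is its counterpart for the sums of the
    current clusters. *)
Definition cen c := (n * d + c * d)%N.
Definition acc c := (n * d + k * d + c * d)%N.

Lemma zero_spec s : nenv s -> renv s ->
  ht (50 * (k * d)) (zero_code R) s (fun s' =>
    [/\ nframe 15 s s' /\ rframe 40 s s',
      forall a, (a < n * d)%N -> rmem s' a = rmem s a,
      forall a, (a < k * d + k * d)%N -> rmem s' (n * d + a)%N = 0,
      forall a, (a < n + n)%N -> nmem s' a = nmem s a &
      forall c, (c < k)%N -> nmem s' (n + n + c)%N = 0%N]).
Proof.
move=> ns rs; rewrite /zero_code; eapply ht_le.
  eapply ht_seq.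
    eapply (@ht_for _ _ _ _ s (k * d + k * d)%N _ (fun j s' =>
      [/\ rframe 40 s s', forall a, (a < n * d)%N -> rmem s' a = rmem s a,
       forall a, (a < j)%N -> rmem s' (n * d + a)%N = 0 &
       nmem s' = nmem s])) => //; [exact: (ne8 ns) | exact: (ne3 ns) |].
    move=> j s1 jB fr s15 [rf lo hi nm].
    eapply ht_ops; apply: ht_skip => /=; split.
      by move=> a a16 /=; rewrite ltn_eqF //; lia.
    rewrite s15 fr // (ne6 ns); split => //=.
    - by move=> a a40; rewrite /= ltn_eqF ?rf.
    - by move=> a aB; rewrite ltn_eqF ?lo//; lia.
    - move=> a aj; rewrite eqn_add2l; case: eqP => // /eqP aj'; apply: hi.
      by rewrite ltn_neqAle aj' -ltnS.
  move=> s1 [fr [rf lo hi nm]].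
  have ns1 : nenv s1 by apply: nenv_frame ns; last exact: fr.
  eapply ht_weak.
    eapply (@ht_for _ _ _ _ s1 k _ (fun j s' =>
      [/\ rframe 40 s1 s', rmem s' = rmem s1,
        forall a, (a < n + n)%N -> nmem s' a = nmem s1 a &
        forall c, (c < j)%N -> nmem s' (n + n + c)%N = 0%N])) => //;
      [exact: (ne2 ns1) | exact: (ne3 ns1) |].
    move=> j s2 jB fr2 s15 [rf2 rm2 lo2 hi2].
    eapply ht_ops; apply: ht_skip => /=; split.
      by move=> a a16 /=; rewrite ltn_eqF //; lia.
    rewrite s15 !fr2 // (ne9 ns1) (ne10 ns1); split => //=.
    - by move=> a aB; rewrite ltn_eqF ?lo2//; lia.
    - move=> a aj; rewrite eqn_add2l; case: eqP => // /eqP aj'; apply: hi2.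
      by rewrite ltn_neqAle aj' -ltnS.
  move=> s2 [fr2 [rf2 rm2 lo2 hi2]]; split=> //.
  - split; first exact: nframe_trans fr2.
    by move=> a a40; rewrite rf2 ?rf.
  - by move=> a aB; rewrite rm2 lo.
  - by move=> a aB; rewrite rm2 hi.
  - by move=> a aB; rewrite lo2 ?nm.
have kd : (k <= k * d)%N by rewrite leq_pmulr.
by rewrite /=; nia.
Qed.

(** * Drawing the sample sums *)

Section Sampling.
Variables (G : nat -> 'rV[R]_d -> bool) (q : R).

Definition xrow i : 'rV[R]_d := \row_j x (i * d + j)%N.
Definition cenrow s c : 'rV[R]_d := \row_j rmem s (cen c + j)%N.

(* The expectation of f (u + the sum of r uniformly chosen points). *)
Fixpoint hit (f : 'rV[R]_d -> R) r u :=
  if r is r'.+1 then (\sum_(i < n) hit f r' (u + xrow i)) / n%:R else f u.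

Hypothesis q0 : 0 <= q.
Hypothesis hitq : forall c, (c < k)%N -> q <= hit (fun u => (G c u)%:R) m 0.

(** The invariant value, [hit] with m - j draws left, is the conditional probability of a good sum
    given the first j draws. A draw averages it, and averaging commutes with the affine map given by
    [v0] and [D] ([lin]). *)
Lemma sample_row_spec s c (v0 D : R) : nenv s -> renv s -> (c < k)%N ->
  nreg s 17 = cen c ->
  trip (m * (25 * d + 20) + 3)
    (For 16 4 (Seq (Draw R 40 0) (ops [:: NMul R 40 40 1; NAdd R 41 17 10] (add_code R)))) s
    (fun s' => nframe 16 s s' /\ [/\ rframe 40 s s', nmem s' = nmem s &
      forall a, ~~ (cen c <= a < cen c + d)%N -> rmem s' a = rmem s a])
    (fun s' => v0 + D * (G c (cenrow s' c))%:R)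
    (v0 + D * hit (fun u => (G c u)%:R) m (cenrow s c)).
Proof.
move=> ns rs ck s17; have ckB := row_bound ck.
have lin r w : v0 + D * ((\sum_(i < n) r i) / n%:R) = w ->
    w = (\sum_(i < n) (v0 + D * r i)) / n%:R.
  move=> <-; rewrite big_split /= sumr_const card_ord -mulr_sumr mulrDl.
  rewrite -(mulr_natr v0 n) mulfK ?pnatr_eq0 -?lt0n// mulrA //.
eapply trip_le.
  eapply trip_weak.
  - apply: (@trip_for _ _ _ _ s m _
      (fun j s' => [/\ nreg s' 17 = cen c, rframe 40 s s', nmem s' = nmem s &
         forall a, ~~ (cen c <= a < cen c + d)%N -> rmem s' a = rmem s a])
      (fun j s' => v0 + D * hit (fun u => (G c u)%:R) (m - j)%N (cenrow s' c))) => //;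
      [exact: (ne4 ns) | exact: (ne3 ns) |].
    move=> j s1 jm fr s16 [s17' rf nm rm].
    have ns1 : nenv s1 by apply: nenv_frame ns; last exact: fr.
    have rs1 a : (a < n * d)%N -> rmem s1 a = x a.
      by move=> aB; rewrite rm ?rex// /cen; lia.
    eapply trip_seq.
      apply: (trip_draw (I := fun s2 => exists2 i, (i < n)%N & s2 = set_nreg s1 40 i)
         (g := fun s2 => v0 + D * hit (fun u => (G c u)%:R) (m - j.+1)%N
            (cenrow s1 c + xrow (nreg s2 40)))).
      - by rewrite (ne0 ns1).
      - by move=> i; rewrite (ne0 ns1) => iB; exists i.
      - rewrite (ne0 ns1) -[(m - j)%N](subnSK jm) /=.
        by rewrite le_eqVlt; apply/orP; left; apply/eqP/lin.
    move=> s2 [i iB ->]; have iBd := leq_mul iB (leqnn d); rewrite mulSnr in iBd.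
    eapply trip_ops; eapply trip_of_ht.
      apply: add_spec; rewrite /= ?(ne1 ns1) ?(ne3 ns1) //.
      by rewrite s17' (ne10 ns1) addn0 /cen; lia.
    move=> s3 [fr3 rf3 nm3 rm3]; split; first split.
    - by move=> a a17; rewrite fr3 ?(ltn_trans a17) //= !ltn_eqF //; lia.
    - split=> /=; rewrite ?fr3 //=.
      + by move=> a aB; rewrite /= rf3 //= rf.
      + by rewrite nm3.
      + move=> a aB; rewrite rm3 /= s17' (ne10 ns1) addn0 (negPf aB).
        exact: rm.
    - rewrite le_eqVlt; apply/orP; left; apply/eqP; congr (_ + _ * hit _ _ _).
      apply/matrixP => u j'; rewrite !mxE rm3 /= s17' (ne10 ns1) (ne1 ns1) addn0.
      by rewrite leq_addr ltn_add2l ltn_ord /= addKn (rs1 (i * d + j')%N) //; have := ltn_ord j'; lia.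
  - move=> s1 [fr [_ rf nm rm]]; split; last by rewrite subnn.
    by split.
  - by rewrite subn0.
by rewrite /=; nia.
Qed.

Definition goodpre s c := \big[andb/true]_(c' < c) G c' (cenrow s c').

(** Each row trades one factor [q] for its indicator: whatever the past, row [c] comes out good with
    probability at least [q]. *)
Lemma sample_spec s (v0 D : R) : 0 <= D -> nenv s -> renv s ->
  (forall a, (a < k * d)%N -> rmem s (n * d + a)%N = 0) ->
  trip (k * (m * (25 * d + 20) + 10) + 3) (sample_code R) s
    (fun s' => nframe 15 s s' /\ [/\ rframe 40 s s', nmem s' = nmem s,
      forall a, (a < n * d)%N -> rmem s' a = rmem s a &
      forall a, (n * d + k * d <= a)%N -> rmem s' a = rmem s a])
    (fun s' => v0 + D * (goodpre s' k)%:R)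
    (v0 + D * q ^+ k).
Proof.
move=> D0 ns rs z; rewrite /sample_code.
eapply trip_le.
  eapply trip_weak.
  - apply: (@trip_for _ _ _ _ s k _
      (fun c s' => [/\ rframe 40 s s', nmem s' = nmem s,
         forall a, (a < n * d)%N -> rmem s' a = rmem s a &
         forall a, (cen c <= a)%N -> rmem s' a = rmem s a])
      (fun c s' => v0 + (D * (goodpre s' c)%:R) * q ^+ (k - c))) => //;
      [exact: (ne2 ns) | exact: (ne3 ns) |].
    move=> c s1 ck fr s15 [rf nm lo hi].
    have ckB := row_bound ck.
    have ns1 : nenv s1 by apply: nenv_frame ns; last exact: fr.
    have rs1 : renv s1.
      by case: rs => *; split; rewrite ?rf// => a aB; rewrite lo //; auto.
    eapply trip_ops; eapply trip_weak.
    + apply: (@sample_row_spec _ c v0 (D * (goodpre s1 c)%:R * q ^+ (k - c.+1))) => //=.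
      * apply: (nenv_frame (b := 16) _ _ ns1) => // a aB /=.
        by rewrite ltn_eqF // (ltn_trans aB).
      * by case: rs1.
      * by rewrite s15 (ne1 ns1) (ne6 ns1) addnC.
    + move=> s2 [fr2 [rf2 nm2 rm2]]; split; [split; [|split=> //=] |].
      * by move=> a aB; rewrite fr2 //= !ltn_eqF //; lia.
      * by move=> a aB; rewrite /= rf2 //= rf.
      * by rewrite nm2.
      * by move=> a aB; rewrite rm2 /= ?lo // /cen; lia.
      * move=> a; rewrite /cen mulSn => aB; rewrite rm2 /= ?hi // /cen; lia.
      (* Sampling row [c] leaves the earlier rows untouched, so their verdict splits off as a
         factor. *)
      * have -> : goodpre (set_nreg s2 15 c.+1) c.+1 = goodpre s1 c && G c (cenrow s2 c).
          rewrite /goodpre big_ord_recr /=; congr (_ && _); apply: eq_bigr => c' _.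
          congr (G _ _); apply/matrixP => u j; rewrite !mxE rm2 //.
          rewrite /cen; have := row_inj c c' (ltn_ord j).
          by rewrite gtn_eqF // => h; apply/negP => ?; lia.
        by case: (goodpre s1 c); case: (G c _); rewrite /= ?(mulr1, mulr0, mul0r).
    + rewrite lerD2l -(subnSK ck) exprSr -!mulrA ler_wpM2l// ler_wpM2l ?ler0n//.
      rewrite ler_wpM2l ?exprn_ge0//.
      (* Row [c] is still as cleared, and [hitq] speaks of sums started at 0. *)
      have -> : cenrow (foldl (fun s0 => (exec (R:=R))^~ s0) s1
           [:: NMul R 17 15 1; NAdd R 17 17 6]) c = 0.
        apply/matrixP => u j; rewrite !mxE /= hi ?leq_addr // /cen -addnA z //.
        by have := ltn_ord j; lia.
      exact: hitq.
  - move=> s1 [fr [rf nm lo hi]]; split; first split => //; last by rewrite subnn mulr1.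
  - by rewrite subn0 /goodpre big_ord0 /= mulr1.
by rewrite /=; nia.
Qed.

End Sampling.

(** * Assignment to the nearest centre *)

Lemma nearest_spec s i : nenv s -> renv s -> (i < n)%N ->
  nreg s 22 = (i * d)%N -> nreg s 21 = 0%N ->
  rreg s 6 = sqdist (rmem s) (i * d) (cen 0) m%:R ->
  ht (k * (25 * d + 20) + 3) (nearest_code R) s (fun s' => nframe 16 s s' /\
    [/\ rframe 6 s s', rmem s' = rmem s /\ nmem s' = nmem s,
      nreg s' 22 = nreg s 22, (nreg s' 21 < k)%N &
      forall c, (c < k)%N ->
        sqdist (rmem s) (i * d) (cen (nreg s' 21)) m%:R <=
        sqdist (rmem s) (i * d) (cen c) m%:R]).
Proof.
move=> ns rs iB s22 s21 s6; rewrite /nearest_code.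
pose I c s' := [/\ rframe 6 s s', rmem s' = rmem s /\ nmem s' = nmem s,
      nreg s' 22 = nreg s 22 /\ (nreg s' 21 < k)%N,
      rreg s' 6 = sqdist (rmem s) (i * d) (cen (nreg s' 21)) m%:R &
      forall c', (c' < c)%N -> rreg s' 6 <= sqdist (rmem s) (i * d) (cen c') m%:R].
eapply ht_le.
  eapply ht_weak.
    apply: (@ht_for _ _ _ _ s k _ I) => //; [exact: (ne2 ns)|exact: (ne3 ns)| |].
      by rewrite /I /= s21.
    move=> c s1 ck fr s16 [rf [rm nm] [r22 r21] r6 le].
    have ns1 : nenv s1 by apply: nenv_frame ns; last exact: fr.
    eapply ht_ops; eapply ht_seq.
      by apply: dist_spec; rewrite /= ?(ne1 ns1) ?(ne3 ns1).
    move=> s2 /= [[fr2 rf2 rm2 nm2]].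
    rewrite rm r22 s22 s16 (ne1 ns1) (ne6 ns1) (ne10 ns1) addn0 !rf // (re3 rs) (re4 rs) addr0.
    rewrite -/(cen c) => r41.
    eapply ht_if; rewrite /= r41 rf2 //= => test.
      eapply ht_ops; apply: ht_skip => /=; split.
        move=> a aB; rewrite /= ltn_eqF; last by lia.
        by rewrite fr2 /= ?ltn_eqF //; lia.
      split=> /=.
      - move=> a aB; rewrite /= ltn_eqF // rf2 /= ?ltn_eqF ?rf //; lia.
      - by rewrite rm2 nm2 /= rm nm.
      - by rewrite !fr2 //= s16 (ne10 ns1) addn0.
      - by rewrite r41 !fr2 //= s16 rf2 //= rf // (re4 rs) addr0 (ne10 ns1) addn0.
      - move=> c'; rewrite ltnS leq_eqVlt r41 rf2 //= rf // (re4 rs) addr0.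
        case/predU1P => [-> //|/le]; apply: le_trans; exact: ltW.
    eapply (ht_le (t' := 1)) => //.
    apply: ht_skip => /=; split.
      by move=> a aB; rewrite fr2 /= ?ltn_eqF //; lia.
    split=> /=.
    - move=> a aB; rewrite rf2 /= ?ltn_eqF ?rf //; lia.
    - by rewrite rm2 nm2 /= rm nm.
    - by rewrite !fr2.
    - by rewrite fr2 //= rf2.
    - move=> c'; rewrite ltnS leq_eqVlt rf2 //=.
      case/predU1P => [->|/le //]; by rewrite leNgt.
  move=> s1 [fr [rf rm [r22 r21] r6 le]]; split=> //; split=> // c /le.
  by rewrite r6.
by rewrite /=; nia.
Qed.

(** Restricted to the first [i] points, so that [csize] and [csum] can serve as invariants of the
    assignment loop; [i = n] gives the actual clusters. *)
Definition csize (l : nat -> nat) i c := \sum_(i' < i) (l i' == c : nat).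
Definition csum (l : nat -> nat) i c j : R :=
  \sum_(i' < i) (if l i' == c then x (i' * d + j)%N else 0).

Lemma csizeS l i c : csize l i.+1 c = (csize l i c + (l i == c))%N.
Proof. by rewrite /csize big_ord_recr. Qed.

Lemma csumS l i c j :
  csum l i.+1 c j = csum l i c j + (if l i == c then x (i * d + j)%N else 0).
Proof. by rewrite /csum big_ord_recr. Qed.

Lemma eq_csize l l' i : (forall i', (i' < i)%N -> l i' = l' i') -> csize l i =1 csize l' i.
Proof. by move=> e c; apply: eq_bigr => i' _; rewrite e. Qed.

Lemma eq_csum l l' i : (forall i', (i' < i)%N -> l i' = l' i') -> csum l i =2 csum l' i.
Proof. by move=> e c j; apply: eq_bigr => i' _; rewrite e. Qed.

Definition label s i := nmem s (n + i).

Definition assigned s s' i := [/\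
  forall a, (a < n)%N -> nmem s' a = nmem s a,
  forall i', (i' < i)%N -> (label s' i' < k)%N /\
    (forall c, (c < k)%N -> sqdist (rmem s) (i' * d) (cen (label s' i')) m%:R <=
       sqdist (rmem s) (i' * d) (cen c) m%:R),
  forall c, (c < k)%N -> nmem s' (n + n + c)%N = csize (label s') i c,
  forall c j, (c < k)%N -> (j < d)%N -> rmem s' (acc c + j)%N = csum (label s') i c j &
  forall a, (a < acc 0)%N -> rmem s' a = rmem s a].

Lemma assign_spec s : nenv s -> renv s ->
  (forall c, (c < k)%N -> nmem s (n + n + c)%N = 0%N) ->
  (forall c j, (c < k)%N -> (j < d)%N -> rmem s (acc c + j)%N = 0) ->
  ht (200 * (n * (k * d))) (assign_code R) s (fun s' =>
    nframe 15 s s' /\ (rframe 6 s s' /\ assigned s s' n)).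
Proof.
move=> ns rs cz rz; rewrite /assign_code; eapply ht_le.
  apply: (@ht_for _ _ _ _ s n _ (fun i s' => rframe 6 s s' /\ assigned s s' i)) => //;
    [exact: (ne0 ns)|exact: (ne3 ns)| |].
    split=> //; split=> //=.
    - by move=> c ck; rewrite cz // /csize big_ord0.
    - by move=> c j ck jd; rewrite rz // /csum big_ord0.
  move=> i s1 iB fr s15 [rf [out near cs sm lo]].
  have ns1 : nenv s1 by apply: nenv_frame ns; last exact: fr.
  have iBd := leq_mul iB (leqnn d); rewrite mulSnr in iBd.
  have rs1 : renv s1.
    case: rs => *; split; rewrite ?rf// => a aB; rewrite lo //; first by auto.
    by rewrite /acc; lia.
  have lo1 i' c : (i' < n)%N -> (c < k)%N ->
      sqdist (rmem s1) (i' * d) (cen c) m%:R = sqdist (rmem s) (i' * d) (cen c) m%:R.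
    move=> i'B ck; have B1 := leq_mul i'B (leqnn d); rewrite mulSnr in B1.
    have := row_bound ck => B2.
    by apply: eq_bigr => j _; rewrite !lo // /acc /cen; have := ltn_ord j; lia.
  eapply ht_ops; eapply ht_seq.
    by apply: dist_spec; rewrite /= ?(ne1 ns1) ?(ne3 ns1).
  move=> s2 /= [[fr2 rf2 rm2 nm2]].
  rewrite s15 (ne1 ns1) (ne6 ns1) (ne10 ns1) !addn0 (re3 rs1) (re4 rs1) addr0 => r41.
  have ns2 : nenv s2.
    apply: (nenv_frame (b := 16) _ _ ns1) => // a aB.
    by rewrite fr2 /= ?ltn_eqF //; lia.
  have rf2' a : (a < 6)%N -> rreg s2 a = rreg s a.
    by move=> aB; rewrite rf2 /= ?ltn_eqF ?rf //; lia.
  have rs2 : renv s2.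
    case: rs1 => *; split; rewrite ?rm2 ?rf2'// -?rf //=.
  eapply ht_ops; eapply ht_seq.
    apply: (@nearest_spec _ i) => //=.
    - exact: (nenv_frame (b := 16) _ _ ns2).
    - by case: rs2 => *; split.
    - by rewrite fr2 //= s15 (ne1 ns1).
    - by rewrite fr2.
    - by rewrite r41 (re4 rs2) addr0 /cen !addn0 rm2.
  move=> s3 /= [fr3 [rf3 [rm3 nm3] r22 r21 le]].
  have fr3' a : (a < 16)%N -> nreg s3 a = nreg s1 a.
    by move=> aB; rewrite fr3 //= fr2 /= ?ltn_eqF //; lia.
  have ns3 : nenv s3.
    by apply: (nenv_frame (b := 16) _ _ ns1).
  have {}r22 : nreg s3 22 = (i * d)%N by rewrite r22 /= fr2 //= s15 (ne1 ns1).
  set c := nreg s3 21 in r21 le *; have cB := row_bound r21.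
  eapply ht_ops; eapply ht_weak.
    apply: add_spec; rewrite /= ?(ne1 ns3) ?(ne3 ns3) //.
    by rewrite r22 (ne7 ns3) (ne10 ns3) addn0; lia.
  move=> s4 /= [fr4 rf4 nm4 rm4]; split.
    by move=> a aB; rewrite fr4 /= ?ltn_eqF ?fr3' //; lia.
  have e0 : (nreg s3 0 = n) by exact: ne0.
  have e9 : (nreg s3 9 = n + n)%N by exact: ne9.
  have mem4 a : nmem s4 a = if a == (n + n + c)%N then (nmem s1 (n + n + c) + 1)%N
      else if a == (n + i)%N then c else nmem s1 a.
    rewrite nm4 /= -/c e9 e0 (ne3 ns3) fr3' // s15.
    rewrite nm3 nm2 /=; case: eqVneq => // _; rewrite ifF //; lia.
  have lab4 i' : (i' < n)%N -> label s4 i' = if i' == i then c else label s1 i'.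
    move=> i'B; rewrite /label mem4 eqn_add2l ifF //; lia.
  have lab4' : forall i', (i' < i)%N -> label s4 i' = label s1 i'.
    by move=> i' i'B; rewrite lab4 ?(ltn_trans i'B) // ltn_eqF.
  have lab4i : label s4 i = c by rewrite lab4 // eqxx.
  split; first by move=> a aB; rewrite /= rf4 /= ?rf3 //= ?ltn_eqF ?rf2' //; lia.
  rewrite (ne7 ns3) (ne1 ns3) (ne10 ns3) addn0 -/(acc c) r22 in rm4.
  change (assigned s s4 i.+1); split.
  - move=> a aB; rewrite mem4 !ifF ?out //; lia.
  - move=> i'; rewrite ltnS leq_eqVlt => /predU1P[->|i'B].
      rewrite lab4i.
      split=> // c' c'k; have := le _ c'k; rewrite rm2 !lo1 //.
    by rewrite lab4' //; apply: near.
  - move=> c' c'k; rewrite csizeS lab4i mem4 eqn_add2l (eq_csize lab4') -cs //.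
    case: (eqVneq c' c) => [->//|c'c].
    rewrite addn0 ifF //; lia.
  - move=> c' j c'k jd; rewrite csumS lab4i (eq_csum lab4') -sm // rm4 rm3 rm2 /= /acc -!addnA !leq_add2l !ltn_add2l.
    rewrite row_inj //; case: (eqVneq c c') => [->|_]; last by rewrite addr0.
    congr (_ + _); rewrite -(rex rs1) //; last by lia.
    by rewrite subnDl subnDl addKn.
  - move=> a aB; rewrite rm4 rm3 rm2 ifF /= ?lo //.
    by move: aB; rewrite /acc; lia.
have kd : (1 <= k * d)%N by rewrite muln_gt0 k0.
have dk : (d <= k * d)%N by rewrite leq_pmull.
have kk : (k <= k * d)%N by rewrite leq_pmulr.
rewrite /=.
have -> : (200 * (n * (k * d)) = n * (200 * (k * d)))%N by rewrite mulnCA.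
apply: (@leq_trans (n * (197 * (k * d)) + 3 * n)); last by nia.
apply: leq_add; last by lia.
rewrite leq_mul2l; apply/orP; right; nia.
Qed.

(** * Exact check of a labelling *)

Definition cdist l i c := \sum_(j < d) (x (i * d + j)%N - csum l n c j / (csize l n c)%:R) ^+ 2.

(** Mirrors the tests of the program, with proximity in squared form. The mean of an empty cluster
    is read as 0, since x / 0 = 0, but such a cluster fails the size test as soon as [bal] is
    positive. *)
Definition valid_at l i c :=
  ~~ ((csize l n c)%:R < bal) && ((c != l i) ==> (al2 * cdist l i (l i) < cdist l i c)).

Definition valid l := \big[andb/true]_(i < n) \big[andb/true]_(c < k) valid_at l i c.

Definition cost l := \sum_(i < n) cdist l i (l i).

Definition sums_of s l := [/\ forall i, (i < n)%N -> label s i = l i /\ (l i < k)%N,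
  forall c, (c < k)%N -> nmem s (n + n + c)%N = csize l n c &
  forall c j, (c < k)%N -> (j < d)%N -> rmem s (acc c + j)%N = csum l n c j].

Lemma sqdist_acc s l i c : renv s -> sums_of s l -> (i < n)%N -> (c < k)%N ->
  sqdist (rmem s) (i * d) (acc c) (csize l n c)%:R = cdist l i c.
Proof.
move=> rs [_ _ sm] iB ck; have iBd := leq_mul iB (leqnn d); rewrite mulSnr in iBd.
apply: eq_bigr => j _; rewrite sm // (rex rs) //; have := ltn_ord j; lia.
Qed.

Lemma bad_spec s Q : Q (set_nreg s 20 0) -> ht 3 (bad_code R) s Q.
Proof. by move=> Qs; apply: (@ht_ops _ 1 [:: _]); apply: ht_skip. Qed.

Lemma prox_spec s l i : nenv s -> renv s -> sums_of s l -> (i < n)%N ->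
  nreg s 21 = l i -> nreg s 22 = (i * d)%N -> rreg s 7 = al2 * cdist l i (l i) ->
  ht (k * (25 * d + 35) + 3) (prox_code R) s (fun s' => nframe 16 s s' /\
    [/\ rframe 8 s s', rmem s' = rmem s, nmem s' = nmem s &
      (0 < nreg s' 20)%N = (0 < nreg s 20)%N && \big[andb/true]_(c < k) valid_at l i c]).
Proof.
move=> ns rs sl iB s21 s22 s7; rewrite /prox_code.
pose I c s' := [/\ rframe 8 s s', rmem s' = rmem s /\ nmem s' = nmem s,
  nreg s' 21 = l i, nreg s' 22 = (i * d)%N &
  (0 < nreg s' 20)%N = (0 < nreg s 20)%N && \big[andb/true]_(c' < c) valid_at l i c'].
eapply ht_le.
  eapply ht_weak.
    apply: (@ht_for _ _ _ _ s k _ I) => //; [exact: (ne2 ns)|exact: (ne3 ns)| |].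
      by split=> //; rewrite big_ord0 andbT.
    move=> c s1 ck fr s16 [rf [rm nm] r21 r22 r20].
    have ns1 : nenv s1 by apply: nenv_frame ns; last exact: fr.
    have sl1 : sums_of s1 l by case: sl => *; split; rewrite ?/label ?rm ?nm.
    have rs1 : renv s1 by case: rs => *; split; rewrite ?rf ?rm.
    eapply ht_ops; eapply ht_seq.
      by apply: dist_spec; rewrite /= ?(ne1 ns1) ?(ne3 ns1).
    move=> s2 /= [[fr2 rf2 rm2 nm2]].
    rewrite s16 r22 (ne1 ns1) (ne7 ns1) (ne9 ns1) (ne10 ns1) addn0 -/(acc c).
    have [_ /(_ c ck) -> _] := sl1; rewrite (sqdist_acc rs1 sl1 iB ck) => r41.
    have r8 : rreg s2 8 = (csize l n c)%:R.
      rewrite rf2 //= s16 (ne9 ns1) (re4 rs1) addr0.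
      by have [_ /(_ c ck) -> _] := sl1.
    have rf2' a : (a < 8)%N -> rreg s2 a = rreg s a.
      by move=> aB; rewrite rf2 /= ?ltn_eqF ?rf //; lia.
    have fr2' a : (a < 17)%N -> nreg s2 a = nreg s1 a.
      by move=> aB; rewrite fr2 /= ?ltn_eqF //; lia.
    have fr20 : nreg s2 20 = nreg s1 20 by rewrite fr2.
    have fr21 : nreg s2 21 = l i by rewrite fr2.
    have fr22 : nreg s2 22 = (i * d)%N by rewrite fr2.
    (* Effect of one check with verdict [b]: only register 20 changes, and its truth value is
       conjoined with [b]. *)
    pose J b s3 := [/\ forall a, a != 20 -> nreg s3 a = nreg s2 a,
      rreg s3 = rreg s2, rmem s3 = rmem s2, nmem s3 = nmem s2 &
      (0 < nreg s3 20)%N = (0 < nreg s2 20)%N && b].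
    have badJ b : ~~ b -> J b (set_nreg s2 20 0).
      move/negPf=> ->; split=> //=; last by rewrite andbF.
      by move=> a /negPf->.
    eapply ht_seq.
      apply: (ht_if (t := 3) (Q := J (~~ ((csize l n c)%:R < bal)))).
        rewrite /= r8 rf2' // (re2 rs) => lt; apply/bad_spec/badJ.
        by rewrite lt.
      rewrite /= r8 rf2' // (re2 rs) => lt.
      apply: (ht_le (t' := 1)) => //; apply: ht_skip.
      by split=> //; rewrite lt andbT.
    move=> s3 [nr3 rr3 rm3 nm3 r20'].
    have final s4 : (forall a, a != 20 -> nreg s4 a = nreg s3 a) ->
        rreg s4 = rreg s3 -> rmem s4 = rmem s3 -> nmem s4 = nmem s3 ->
        (0 < nreg s4 20)%N = (0 < nreg s3 20)%N &&
          ((c != l i) ==> (al2 * cdist l i (l i) < cdist l i c)) ->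
        nframe 17 s1 s4 /\ I c.+1 (set_nreg s4 16 c.+1).
      move=> nr4 rr4 rm4 nm4 r204; split.
        move=> a aB; rewrite nr4 ?nr3 ?fr2' //; lia.
      split=> /=.
      - by move=> a aB; rewrite /= rr4 rr3 rf2'.
      - by rewrite rm4 rm3 rm2 nm4 nm3 nm2.
      - by rewrite nr4 ?nr3.
      - by rewrite nr4 ?nr3.
      - by rewrite r204 r20' fr20 r20 big_ord_recr /= !andbA.
    have s3_16 : nreg s3 16 = c by rewrite nr3 // fr2'.
    have s3_21 : nreg s3 21 = l i by rewrite nr3.
    have tests : (holds (RLt 7 41) s3) = (al2 * cdist l i (l i) < cdist l i c).
      by rewrite /= rr3 r41 rf2' // s7.
    have prox : c != l i -> ht 4 (If (RLt 7 41) (Skip R) (bad_code R)) s3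
        (fun s4 => nframe 17 s1 s4 /\ I c.+1 (set_nreg s4 16 c.+1)).
      move=> cl; apply: ht_if; rewrite tests => lt.
        by apply: (ht_le (t' := 1)) => //; apply/ht_skip/final => //; rewrite lt cl andbT.
      apply: bad_spec; apply: final => //=.
        by move=> a /negPf->.
      by rewrite cl (negPf lt) andbF.
    apply: (ht_if (t := 5)); rewrite [holds _ _]/= s3_16 s3_21 => cl.
      by apply: (ht_le (t' := 4)) => //; apply: prox; rewrite ltn_eqF.
    apply: ht_if; rewrite [holds _ _]/= s3_16 s3_21 => lc.
      by apply: prox; rewrite gtn_eqF.
    apply: (ht_le (t' := 1)) => //; apply/ht_skip/final => //.
    have cE : c == l i by rewrite eqn_leq (leqNgt c) lc (leqNgt (l i)) cl.
    by rewrite cE andbT.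
  move=> s1 [fr [rf [rm nm] _ _ r20]]; split=> //.
by rewrite /=; nia.
Qed.

Lemma check_spec s l : nenv s -> renv s -> sums_of s l ->
  ht (200 * (n * (k * d))) (check_code R) s (fun s' => nframe 15 s s' /\
    [/\ rframe 5 s s', rmem s' = rmem s, nmem s' = nmem s,
      (0 < nreg s' 20)%N = valid l & rreg s' 5 = cost l]).
Proof.
move=> ns rs sl; rewrite /check_code.
pose I i s' := [/\ rframe 5 s s', rmem s' = rmem s /\ nmem s' = nmem s,
  (0 < nreg s' 20)%N = \big[andb/true]_(i' < i) \big[andb/true]_(c < k) valid_at l i' c &
  rreg s' 5 = \sum_(i' < i) cdist l i' (l i')].
eapply ht_le.
  eapply ht_ops; eapply ht_weak.
    apply: (@ht_for _ _ _ _ _ n _ I) => //=; [exact: (ne0 ns)|exact: (ne3 ns)| |].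
      split=> //=; rewrite ?big_ord0 //.
      by move=> a aB; rewrite /= ltn_eqF.
    move=> i s1 iB fr s15 [rf [rm nm] r20 r5].
    have ns1 : nenv s1.
      apply: (nenv_frame (b := 15) _ _ ns) => // a aB.
      by rewrite fr //= ltn_eqF //; lia.
    have sl1 : sums_of s1 l by case: sl => *; split; rewrite ?/label ?rm ?nm.
    have rs1 : renv s1 by case: rs => *; split; rewrite ?rf ?rm.
    have [/(_ i iB)[s1i liB] cs1 _] := sl1; rewrite /label in s1i.
    eapply ht_ops; eapply ht_seq.
      by apply: dist_spec; rewrite /= ?(ne1 ns1) ?(ne3 ns1).
    move=> s2 /= [[fr2 rf2 rm2 nm2]].
    rewrite s15 (ne0 ns1) (ne1 ns1) (ne7 ns1) (ne9 ns1) (ne10 ns1) addn0 s1i -/(acc _).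
    rewrite cs1 // (sqdist_acc rs1 sl1 iB liB) => r41.
    have fr2' a : (a < 16)%N -> nreg s2 a = nreg s1 a.
      by move=> aB; rewrite fr2 /= ?ltn_eqF //; lia.
    have rf2' a : (a < 8)%N -> rreg s2 a = rreg s1 a.
      by move=> aB; rewrite rf2 /= ?ltn_eqF //; lia.
    eapply ht_ops; eapply ht_weak.
      apply: (@prox_spec _ l i) => //=.
      - by apply: (nenv_frame (b := 15) _ _ ns1) => // a aB; rewrite /= fr2' // (ltn_trans aB).
      - by case: rs1 => *; split; rewrite /= ?rf2' ?rm2.
      - by case: sl1 => *; split; rewrite ?/label /= ?rm2 ?nm2.
      - by rewrite fr2 //= s15 (ne0 ns1).
      - by rewrite fr2 //= s15 (ne1 ns1).
      - by rewrite rf2' // (re1 rs1) r41.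
    move=> s3 [fr3 [rf3 rm3 nm3 r203]]; split.
      by move=> a aB; rewrite fr3 //= fr2'.
    split=> /=.
    - by move=> a aB; rewrite /= rf3 /= ?ltn_eqF ?rf2' ?rf //; lia.
    - by rewrite rm3 nm3 /= rm2 nm2 /= rm nm.
    - by rewrite r203 /= fr2 //= r20 big_ord_recr.
    - by rewrite rf3 //= rf2' // r5 r41 big_ord_recr.
  move=> s1 [fr [rf [rm nm] r20 r5]]; split=> //.
  by move=> a aB; rewrite fr //= ltn_eqF //; lia.
have dk : (d <= k * d)%N by rewrite leq_pmull.
have kk : (k <= k * d)%N by rewrite leq_pmulr.
have -> : (200 * (n * (k * d)) = n * (200 * (k * d)))%N by rewrite mulnCA.
rewrite /=; apply: (@leq_trans (n * (190 * (k * d)) + 8 * n)); last by nia.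
rewrite addnA (addnC _ (n * _)%N) -addnA; apply: leq_add; last by lia.
rewrite leq_mul2l; apply/orP; right; nia.
Qed.

(** Soundness invariant, independent of luck: it turns a stored cost of at most the optimum into
    optimality of the output. *)
Definition best s := nreg s 13 = 0%N \/ nreg s 13 = 1%N /\
  exists l, [/\ valid l, forall i, (i < n)%N -> nmem s i = l i /\ (l i < k)%N &
    rreg s 0 = cost l].

Variable opt : R.
Definition found s := (0 < nreg s 13)%N && (rreg s 0 <= opt).

(** Overwriting only on strict improvement makes [found] irreversible, so a single lucky trial
    suffices. *)
Lemma update_spec s l : nenv s -> renv s -> sums_of s l -> best s ->
  (0 < nreg s 20)%N = valid l -> rreg s 5 = cost l ->
  ht (100 * n) (update_code R) s (fun s' => nframe 13 s s' /\
    [/\ best s', (forall a, (0 < a < 5)%N -> rreg s' a = rreg s a), rmem s' = rmem s &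
      found s || (valid l && (cost l <= opt)) -> found s']).
Proof.
move=> ns rs [sl _ _] bs s20 s5; rewrite /update_code.
eapply (ht_le (t' := (7 + (7 + 20 * n).+1).+2)); last by lia.
apply: ht_if; rewrite /= (ne10 ns) s20 => vl; last first.
  by apply: (ht_le (t' := 1)) => //; apply: ht_skip; rewrite (negPf vl) orbF.
rewrite vl /=; apply: (ht_seq (I := fun s1 => [/\ forall a, (a < 15)%N -> nreg s1 a = nreg s a,
    forall a, (0 < a < 6)%N -> rreg s1 a = rreg s a, rmem s1 = rmem s /\ nmem s1 = nmem s &
    if nreg s 13 is 0%N then rreg s1 0 = cost l + 1 else rreg s1 0 = rreg s 0])).
  apply: (ht_if (t := 6)); rewrite /= (ne3 ns) => f0.
    eapply ht_le; [eapply ht_ops; apply: ht_skip; split=> //= | by []].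
      by move=> a /andP[a0 a6]; rewrite gtn_eqF // ltn_eqF //; lia.
    by case: (nreg s 13) f0 => //= _; rewrite (ne3 ns) s5.
  apply: (ht_le (t' := 1)) => //; apply: ht_skip; split=> //=.
  by case: (nreg s 13) f0.
move=> s1 [nr rr [rm nm] r0].
have r0E : (rreg s1 5 < rreg s1 0) = (nreg s 13 == 0%N) || (cost l < rreg s 0).
  rewrite rr // s5; case: (nreg s 13) r0 => [->|b ->] //=.
  by rewrite ltrDl ltr01.
apply: ht_if; rewrite /= r0E => lt; last first.
  apply: (ht_le (t' := 1)) => //.
  apply: ht_skip; split; first by move=> a aB; rewrite nr // (ltn_trans aB).
  move: lt; rewrite negb_or -leNgt => /andP[f1 le].
  have {}r0 : rreg s1 0 = rreg s 0 by case: (nreg s 13) f1 r0.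
  split=> //.
  - case: bs => [e|]; first by rewrite e in f1.
    case=> e [l' [v' m' c']]; right; rewrite nr //; split=> //.
    by exists l'; rewrite nm r0.
  - by move=> a /andP[a0 a5]; rewrite rr // a0 (leq_trans a5).
  - rewrite /found nr // r0 lt0n f1 /=; case/orP=> [//|].
    exact: le_trans.
pose I i s' := [/\ nreg s' 13 = 1%N, forall a, (0 < a < 5)%N -> rreg s' a = rreg s a,
  rreg s' 0 = cost l /\ rmem s' = rmem s, forall i', (i' < i)%N -> nmem s' i' = l i' &
  forall i', (i' < n)%N -> nmem s' (n + i')%N = l i'].
eapply ht_le.
  eapply ht_ops; eapply ht_weak.
    apply: (@ht_for _ _ _ _ _ n _ I) => //=; rewrite ?nr ?(ne0 ns) ?(ne3 ns) //.
      split=> //=.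
      - move=> a /andP[a0 a5]; rewrite gtn_eqF // rr // a0 ltnS; lia.
      - by rewrite !rr // (re4 rs) addr0 s5.
      - by move=> i' /sl[+ _]; rewrite /label nm.
    move=> i s2 iB fr s15 [r13 rr2 [r20 rm2] done todo].
    have e0 : nreg s2 0 = n by rewrite fr //= nr // (ne0 ns).
    eapply ht_ops; apply: ht_skip; split=> /=.
      by move=> a aB; rewrite /= !ltn_eqF //; lia.
    split=> //=.
    - move=> i'; rewrite ltnS leq_eqVlt s15 e0 => /predU1P[->|i'i].
        by rewrite eqxx todo.
      by rewrite ltn_eqF // done.
    - by move=> i' i'B; rewrite s15 ifF ?todo //; lia.
  move=> s2 [fr [r13 rr2 [r20 rm2] done _]]; split.
    by move=> a aB; rewrite fr /= ?ltn_eqF ?nr //; lia.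
  split=> //.
  - right; split=> //; exists l; split=> // i iB; split; first exact: done.
    by have [] := sl i iB.
  - rewrite /found r13 r20 /=; case/orP => // /andP[f0 le].
    case/orP: lt => [/eqP e|/ltW c]; first by rewrite e in f0.
    exact: le_trans le.
rewrite /=; lia.
Qed.

(** * One trial and its repetition *)

Section Trial.
Variables (G : nat -> 'rV[R]_d -> bool) (q : R).
Hypotheses (q0 : 0 <= q) (q1 : q <= 1).
Hypothesis hitq : forall c, (c < k)%N -> q <= hit (fun u => (G c u)%:R) m 0.

Definition rowdist i (u : 'rV[R]_d) := \sum_(j < d) (x (i * d + j)%N - u 0 j / m%:R) ^+ 2.

(** All geometry enters the analysis of the program through this and [hitq]. Every nearest labelling
    is covered, so the way ties are broken is irrelevant. *)
Hypothesis Gopt : forall (S : nat -> 'rV[R]_d) l,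
  (forall c, (c < k)%N -> G c (S c)) ->
  (forall i, (i < n)%N -> (l i < k)%N /\
     forall c, (c < k)%N -> rowdist i (S (l i)) <= rowdist i (S c)) ->
  valid l && (cost l <= opt).

Definition cleared s := (forall c, (c < k)%N -> nmem s (n + n + c)%N = 0%N) /\
  (forall c j, (c < k)%N -> (j < d)%N -> rmem s (acc c + j)%N = 0).

Lemma finish_spec s : nenv s -> renv s -> best s -> cleared s ->
  ht (600 * (n * (k * d)))
     (Seq (assign_code R) (Seq (check_code R) (update_code R))) s
     (fun s' => nframe 13 s s' /\ [/\ renv s', best s' &
        found s || goodpre G s k -> found s']).
Proof.
move=> ns rs bs [cz rz]; eapply ht_le.
  eapply ht_seq; first exact: assign_spec.
  move=> s1 [fr1 [rf1 [out near cs sm lo]]].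
  have ns1 : nenv s1 by apply: nenv_frame ns; last exact: fr1.
  have rs1 : renv s1.
    case: rs => *; split; rewrite ?rf1// => a aB; rewrite lo //; first by auto.
    by rewrite /acc; lia.
  have sl1 : sums_of s1 (label s1) by split=> // i /near[].
  eapply ht_seq; first by apply: check_spec sl1.
  move=> s2 [fr2 [rf2 rm2 nm2 s20 s5]].
  have ns2 : nenv s2 by apply: nenv_frame ns1; last exact: fr2.
  have rs2 : renv s2 by case: rs1 => *; split; rewrite ?rf2 ?rm2.
  have sl2 : sums_of s2 (label s1) by case: sl1 => *; split; rewrite ?/label ?rm2 ?nm2.
  have e13 : nreg s2 13 = nreg s 13 by rewrite fr2 // fr1.
  have e0 : rreg s2 0 = rreg s 0 by rewrite rf2 // rf1.
  have bs2 : best s2.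
    case: bs => [b|[b [l [vl ll cl]]]]; [left|right]; rewrite e13 //; split=> //.
    exists l; rewrite e0; split=> // i iB; rewrite nm2 out //; exact: ll.
  eapply ht_weak; first by apply: update_spec sl2 bs2 s20 s5.
  move=> s3 [fr3 [bs3 rr3 rm3 f3]]; split.
    by move=> a aB; rewrite fr3 // fr2 ?fr1 //; lia.
  split=> //; first by case: rs2 => *; split; rewrite ?rr3 ?rm3.
  move=> fg; apply: f3; rewrite /found e13 e0 -/(found s).
  case/orP: fg => [->//|g]; apply/orP; right; apply: (Gopt (S := cenrow s)).
    move=> c ck; move: g; rewrite /goodpre big_andE => /forallP/(_ (Ordinal ck)).
    by [].
  move=> i iB; have [lk le] := near i iB; split=> // c ck.
  have iBd := leq_mul iB (leqnn d); rewrite mulSnr in iBd.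
  have E c' : rowdist i (cenrow s c') = sqdist (rmem s) (i * d) (cen c') m%:R.
    by apply: eq_bigr => j _; rewrite mxE [rmem s (i * d + j)%N](rex rs) //; have := ltn_ord j; lia.
  by rewrite !E le.
have kd : (1 <= k * d)%N by rewrite muln_gt0 k0.
by nia.
Qed.

Lemma trial_spec s (v0 D : R) : 0 <= D -> nenv s -> renv s -> best s ->
  trip (1000 * (n * (k * d)) + 100 * (k * (m * d))) (trial_code R) s
    (fun s' => nframe 13 s s' /\ renv s' /\ best s')
    (fun s' => v0 + D * (found s')%:R)
    (v0 + D * (if found s then 1 else q ^+ k)).
Proof.
move=> D0 ns rs bs; rewrite /trial_code; eapply trip_le.
  eapply trip_seq.
    eapply trip_of_ht; first exact: zero_spec.
    by move=> s1 s1P; split; [exact: s1P | exact: lexx].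
  move=> s1 [[fr1 rf1] lo1 z1 out1 cz1].
  have ns1 : nenv s1 by apply: nenv_frame ns; last exact: fr1.
  have rs1 : renv s1 by case: rs => *; split; rewrite ?rf1// => a aB; rewrite lo1; auto.
  (* If a clustering of cost at most [opt] is already stored, the draws no longer matter and the
     value is constant; otherwise it is affine in the verdict on the sampled sums. *)
  pose D' := if found s then 0 else D.
  pose v' := if found s then v0 + D else v0.
  eapply trip_seq.
    eapply trip_weak.
    - apply: (sample_spec q0 hitq (v0 := v') (D := D')) => //.
      + by rewrite /D'; case: ifP.
      + by move=> a aB; rewrite z1 //; lia.
    - move=> s2 H; split; [exact: H | exact: lexx].
    - by rewrite /v' /D'; case: ifP; rewrite ?mul0r ?addr0 ?mulr1.
  move=> s2 [fr2 [rf2 nm2 lo2 hi2]].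
  have ns2 : nenv s2 by apply: nenv_frame ns1; last exact: fr2.
  have rs2 : renv s2 by case: rs1 => *; split; rewrite ?rf2// => a aB; rewrite lo2; auto.
  have e13 : nreg s2 13 = nreg s 13 by rewrite fr2 // fr1.
  have e0 : rreg s2 0 = rreg s 0 by rewrite rf2 // rf1.
  have bs2 : best s2.
    case: bs => [b|[b [l [vl ll cl]]]]; [left|right]; rewrite e13 //; split=> //.
    exists l; rewrite e0; split=> // i iB; rewrite nm2 out1; [exact: ll | lia].
  eapply trip_of_ht.
    apply: finish_spec => //; split; first by move=> c ck; rewrite nm2 cz1.
    move=> c j ck jd; have := row_bound ck => cB.
    rewrite hi2 /acc; last by lia.
    by rewrite -!addnA z1 //; lia.
  move=> s3 [fr3 [rs3 bs3 f3]]; split.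
    by split=> // a aB; rewrite fr3 // fr2 ?fr1 //; lia.
  rewrite /v' /D'; move: f3; rewrite /found e13 e0 -/(found s).
  case: (found s) => /= [/(_ isT)->|]; first by rewrite mul0r addr0 mulr1.
  by case: goodpre => [/(_ isT)-> //|_]; rewrite mulr0 addr0 lerDl mulr_ge0.
have kd : (1 <= k * d)%N by rewrite muln_gt0 k0.
have kk : (k <= k * d)%N by rewrite leq_pmulr.
have md : (m <= m * d)%N by rewrite leq_pmulr.
have A : (k * (m * (25 * d + 20) + 10) <= 45 * (k * (m * d)) + 10 * (k * d))%N.
  rewrite mulnDr; apply: leq_add; last by lia.
  rewrite [(45 * _)%N]mulnCA leq_mul2l mulnDr; apply/orP; right; lia.
have B : (k * d <= n * (k * d))%N by rewrite leq_pmull.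
lia.
Qed.

Lemma trials_spec s : nenv s -> renv s -> best s -> ~~ found s -> forall v0 D : R, 0 <= D ->
  trip (N * (1000 * (n * (k * d)) + 100 * (k * (m * d)) + 3) + 3) (For 12 5 (trial_code R)) s
    best (fun s' => v0 + D * (found s')%:R) (v0 + D * (1 - (1 - q ^+ k) ^+ N)).
Proof.
move=> ns rs bs nf v0 D D0.
have Q0 : 0 <= q ^+ k by rewrite exprn_ge0.
have Q1 : 0 <= 1 - q ^+ k by rewrite subr_ge0 exprn_ile1.
eapply trip_weak.
- apply: (@trip_for _ _ _ _ s N _ (fun j s' => renv s' /\ best s')
    (fun j s' => v0 + D * (if found s' then 1 else 1 - (1 - q ^+ k) ^+ (N - j)))) => //;
    [exact: (ne5 ns)|exact: (ne3 ns)|by case: rs| ].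
  move=> j s1 jN fr s12 [rs1 bs1].
  have ns1 : nenv s1 by apply: nenv_frame ns; last exact: fr.
  set P := (1 - q ^+ k) ^+ (N - j.+1).
  have P0 : 0 <= P by rewrite exprn_ge0.
  eapply trip_weak.
  (* The later trials all fail with probability at most P: they secure v0 + D (1 - P), and a success
     now adds the missing D P. *)
  + apply: (trial_spec (v0 := v0 + D * (1 - P)) (D := D * P)) => //.
    by rewrite mulr_ge0.
  + move=> s2 [fr2 [rs2 bs2]]; split.
      by split=> //; split=> //; case: rs2.
    rewrite {2}/found /= -/(found s2); case: (found s2); rewrite ?mulr1 ?mulr0 ?addr0 //=.
    by rewrite -addrA -mulrDr subrK mulr1.
  + rewrite -addrA lerD2l -(subnSK jN) exprS -/P -mulrA -mulrDr ler_wpM2l //.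
    by case: (found s1); rewrite ?mulr1; lra.
- move=> s' [_ [_ bs']]; split=> //; rewrite subnn expr0 subrr.
  by case: (found s').
- by rewrite subn0 {1}/found /= -/(found s) (negPf nf).
Qed.

Lemma power_spec s B : nreg s 2 = k -> nreg s 3 = 1%N -> nreg s 4 = m ->
  nreg s 11 = B -> nreg s 17 = 1%N ->
  ht (50 * (k * m.+1)) (power_code R) s (fun s' =>
    [/\ nframe 15 s s', rframe 40 s s', rmem s' = rmem s & nreg s' 17 = ((2 * B ^ m) ^ k)%N]).
Proof.
move=> s2 s3 s4 s11 s17; rewrite /power_code.
pose J v s' := [/\ rframe 40 s s', rmem s' = rmem s & nreg s' 17 = v].
eapply ht_le.
  eapply ht_weak.
    apply: (@ht_for _ _ _ _ s k _ (fun j => J ((2 * B ^ m) ^ j)%N) s2 s3) => //.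
    move=> j s5 jk fr s15 [rf rm r17].
    have f3 a : (a < 15)%N -> nreg s5 a = nreg s a by move=> aB; rewrite fr.
    eapply ht_ops; eapply ht_weak.
      apply: (@ht_for _ _ _ _ _ m _ (fun i => J ((2 * B ^ m) ^ j * 2 * B ^ i)%N)) => //.
      + by rewrite /= f3.
      + by rewrite /= f3.
      + by split=> //=; rewrite r17 expn0 muln1 addnn muln2.
      move=> i s6 im fr6 s16 [rf6 rm6 r176].
      eapply ht_ops; apply: ht_skip; split=> /=.
        by move=> a aB; rewrite /= ltn_eqF // (leq_trans aB).
      split=> //=; rewrite r176 fr6 //= f3 // s11 expnSr mulnA; reflexivity.
    move=> s6 [fr6 [rf6 rm6 r176]]; split.
      by move=> a aB; rewrite fr6 //= ltn_eqF // (leq_trans aB).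
    by split=> //=; rewrite r176 expnSr mulnA.
  by move=> s5 [fr [rf rm r17]]; split.
by rewrite /=; nia.
Qed.

(** Register 5 is patched to [N] in the conclusion because the number of trials is computed only
    afterwards, by [power_code]. *)
Lemma init_nat_spec s W : nreg s 0 = n -> nreg s 1 = d -> nreg s 2 = k ->
  ht 30 (init_nat_code R m W) s (fun s' =>
    [/\ nenv (set_nreg s' 5 N), nreg s' 11 = (W * k)%N, nreg s' 13 = 0%N,
        nreg s' 17 = 1%N & rmem s' = rmem s]).
Proof.
move=> s0 s1 s2; eapply ht_le.
  eapply ht_ops; apply: ht_skip; split=> //; last by rewrite /= s2.
  by split; rewrite /= ?s0 ?s1 ?s2 //; lia.
by [].
Qed.

Lemma init_real_spec s om : bal = om * n%:R / k%:R ->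
  nreg s 0 = n -> nreg s 2 = k -> nreg s 4 = m ->
  (forall a, (a < n * d)%N -> rmem s a = x a) ->
  ht 20 (init_real_code al2 om) s (fun s' => nreg s' = nreg s /\ renv s').
Proof.
move=> balE s0 s2 s4 sx; eapply ht_le.
  eapply ht_ops; apply: ht_skip; split=> //.
  by split; rewrite /= ?s0 ?s2 ?s4.
by [].
Qed.

Lemma init_spec s (W : nat) om : N = ((2 * (W * k) ^ m) ^ k)%N -> bal = om * n%:R / k%:R ->
  nreg s 0 = n -> nreg s 1 = d -> nreg s 2 = k ->
  (forall a, (a < n * d)%N -> rmem s a = x a) ->
  ht (200 * (k * m.+1)) (init_code m W al2 om) s
    (fun s' => [/\ nenv s', renv s' & nreg s' 13 = 0%N]).
Proof.
move=> NE balE s0 s1 s2 sx; rewrite /init_code; eapply ht_le.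
  eapply ht_seq; first exact: init_nat_spec.
  move=> s3 [e3 r11 r13 r17 rm3]; case: e3 => /= *; eapply ht_seq.
    by apply: init_real_spec => // a aB; rewrite rm3 sx.
  move=> s4 [nr4 rs4]; eapply ht_seq.
    by apply: (@power_spec _ (W * k)); rewrite nr4.
  rewrite -NE => s5 [fr rf rm r5]; eapply ht_ops; apply: ht_skip; split.
  - by split=> /=; rewrite ?r5 !fr // nr4 //; lia.
  - by case: rs4 => *; split=> /=; rewrite ?rf ?rm.
  - by rewrite /= fr // nr4.
have : (0 < k * m.+1)%N by rewrite muln_gt0 k0.
by rewrite /=; lia.
Qed.

Lemma main_spec s (W : nat) om (v0 D : R) : N = ((2 * (W * k) ^ m) ^ k)%N -> (0 < N)%N ->
  bal = om * n%:R / k%:R ->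
  nreg s 0 = n -> nreg s 1 = d -> nreg s 2 = k ->
  (forall a, (a < n * d)%N -> rmem s a = x a) -> 0 <= D ->
  trip (2000 * (N * (k * m.+1) * (n * d))) (main_code m W al2 om) s best
    (fun s' => v0 + D * (found s')%:R) (v0 + D * (1 - (1 - q ^+ k) ^+ N)).
Proof.
move=> NE N0 balE s0 s1 s2 sx D0; rewrite /main_code; eapply trip_le.
  eapply trip_seq.
    eapply trip_of_ht; first exact: init_spec NE balE s0 s1 s2 sx.
    by move=> s' s'P; split; [exact: s'P | exact: lexx].
  move=> s' [ns' rs' s13]; apply: trials_spec => //; first by left.
  by rewrite /found s13.
rewrite -[(_.+1)%N]addn1.
set nd := (n * d)%N; have nd0 : (0 < nd)%N by rewrite muln_gt0 n0.
set K := (k * m.+1)%N; have K0 : (0 < K)%N by rewrite muln_gt0 k0.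
have A : (n * (k * d) <= K * nd)%N.
  by rewrite mulnCA /K -mulnA leq_mul2l leq_pmull // orbT.
have B : (k * (m * d) <= K * nd)%N.
  rewrite /K -mulnA leq_mul2l; apply/orP; right; apply: leq_mul => //.
  by rewrite leq_pmull.
have C : (K <= K * nd)%N by rewrite leq_pmulr.
have E : (K * nd <= N * (K * nd))%N by rewrite leq_pmull.
have F : (N * (1000 * (n * (k * d)) + 100 * (k * (m * d)) + 3) <= N * (1103 * (K * nd)))%N.
  by rewrite leq_mul2l; apply/orP; right; lia.
rewrite -mulnA; lia.
Qed.
End Trial.
End Specs.

(** * Recovering a proximal clustering from sample means *)

Section Euclid.
Variables (R : realType) (d : nat).
Implicit Types u v w : 'rV[R]_d.

Definition dotr u v : R := \sum_j u 0 j * v 0 j.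

Lemma enorm_ge0 u : 0 <= enorm u.
Proof. exact: sqrtr_ge0. Qed.

Lemma enorm_sqr u : enorm u ^+ 2 = dotr u u.
Proof.
rewrite sqr_sqrtr; last by rewrite sumr_ge0 // => j _; rewrite sqr_ge0.
by apply: eq_bigr => j _; rewrite expr2.
Qed.

Lemma dotrr_ge0 u : 0 <= dotr u u.
Proof. by rewrite -enorm_sqr sqr_ge0. Qed.

Lemma dotrC u v : dotr u v = dotr v u.
Proof. by apply: eq_bigr => j _; rewrite mulrC. Qed.

Lemma dotrDl u v w : dotr (u + v) w = dotr u w + dotr v w.
Proof. by rewrite -big_split; apply: eq_bigr => j _; rewrite mxE mulrDl. Qed.

Lemma dotrZl (a : R) u v : dotr (a *: u) v = a * dotr u v.
Proof. by rewrite mulr_sumr; apply: eq_bigr => j _; rewrite mxE mulrA. Qed.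

Lemma dotrDr u v w : dotr w (u + v) = dotr w u + dotr w v.
Proof. by rewrite dotrC dotrDl !(dotrC w). Qed.

Lemma dotrZr (a : R) u v : dotr u (a *: v) = a * dotr u v.
Proof. by rewrite dotrC dotrZl dotrC. Qed.

Lemma dotr_eq0 u : dotr u u = 0 -> u = 0.
Proof.
move=> /eqP; rewrite psumr_eq0 => [/allP h|j _]; last by rewrite -expr2 sqr_ge0.
apply/matrixP => i j; rewrite ord1 mxE; have /implyP/(_ isT) := h j (mem_index_enum j).
by rewrite mulf_eq0 orbb => /eqP.
Qed.

(** The squared norm of (v.v) u - (u.v) v is v.v times the gap in the inequality. *)
Lemma cauchy_schwarz u v : dotr u v ^+ 2 <= dotr u u * dotr v v.
Proof.
have [v0|v0] := eqVneq (dotr v v) 0.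
  rewrite v0 mulr0 (dotr_eq0 v0) /dotr big1 ?expr0n // => j _.
  by rewrite mxE mulr0.
have vp : 0 < dotr v v by rewrite lt_def v0 dotrr_ge0.
rewrite -subr_ge0 -(pmulr_rge0 _ vp).
have := dotrr_ge0 (dotr v v *: u + (- dotr u v) *: v).
rewrite !(dotrDl, dotrDr, dotrZl, dotrZr) (dotrC v u).
by congr (0 <= _); ring.
Qed.

Lemma enormD u v : enorm (u + v) <= enorm u + enorm v.
Proof.
rewrite -ler_sqr ?nnegrE ?addr_ge0 ?enorm_ge0 // sqrrD !enorm_sqr.
rewrite dotrDl !dotrDr (dotrC v u) -addrA -[leRHS]addrA lerD2l addrA lerD2r.
rewrite -mulr2n lerMn2r /=; apply: le_trans (ler_norm _) _.
rewrite -ler_sqr ?nnegrE ?mulr_ge0 ?enorm_ge0 ?normr_ge0 //.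
by rewrite real_normK ?num_real // exprMn !enorm_sqr cauchy_schwarz.
Qed.

Lemma enormN u : enorm (- u) = enorm u.
Proof. by congr Num.sqrt; apply: eq_bigr => j _; rewrite mxE sqrrN. Qed.

Lemma enormB_le u v w : enorm (u - w) <= enorm (u - v) + enorm (v - w).
Proof. by rewrite -[u - w](subrKA v) enormD. Qed.

Lemma enormBC u v : enorm (u - v) = enorm (v - u).
Proof. by rewrite -enormN opprB. Qed.

(* With r, s the distances of x to the two means and D <= r + s their distance,
   r + (a - 1) / 3 * D < s follows from a * r < s and (a - 1) * (2 - a) >= 0. *)
Lemma nearest_center (a : R) (x mA mB cA cB : 'rV[R]_d) : 1 < a -> a <= 2 ->
  a * enorm (x - mA) < enorm (x - mB) ->
  enorm (cA - mA) <= (a - 1) / 6 * enorm (mA - mB) ->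
  enorm (cB - mB) <= (a - 1) / 6 * enorm (mA - mB) ->
  enorm (x - cA) < enorm (x - cB).
Proof.
move=> a1 a2 prox hA hB.
have tA := enormB_le x mA cA; rewrite (enormBC mA) in tA.
have tB := enormB_le x cB mB.
have tD := enormB_le mA x mB; rewrite (enormBC mA x) in tD.
have r0 := enorm_ge0 (x - mA).
set r := enorm (x - mA) in prox tA tD r0; set s := enorm (x - mB) in prox tB tD.
have : (a - 1) / 6 * enorm (mA - mB) <= (a - 1) / 6 * (r + s).
  by rewrite ler_wpM2l //; lra.
set D := (a - 1) / 6 * enorm (mA - mB) in hA hB *.
suff : r + 2 * ((a - 1) / 6 * (r + s)) < s by lra.
suff : r * (a + 2) < s * (4 - a) by lra.
have h1 : a * r * (4 - a) < s * (4 - a) by rewrite ltr_pM2r //; lra.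
(* Used through a (4 - a) - (a + 2) = (a - 1) (2 - a). *)
have h2 : 0 <= r * ((a - 1) * (2 - a)) by rewrite !mulr_ge0 //; lra.
by apply: le_lt_trans h1; rewrite -subr_ge0; move: h2; congr (0 <= _); ring.
Qed.

Lemma cluster_radius (a : R) (x mA mB : 'rV[R]_d) : 1 < a ->
  a * enorm (x - mA) < enorm (x - mB) -> (a - 1) * enorm (x - mA) <= enorm (mA - mB).
Proof. by move=> a1 prox; have := enormB_le x mA mB; lra. Qed.

End Euclid.

(** * Second moment of a sampled sum *)

Section SampleMean.
Variables (R : realType) (n d : nat) (X : 'I_n -> 'rV[R]_d) (C : {set 'I_n}).
Hypothesis C0 : (0 < #|C|)%N.
Implicit Types (f g : 'rV[R]_d -> R) (u v w : 'rV[R]_d).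

Definition variance : R :=
  (\sum_(i in C) enorm (X i - mean X C) ^+ 2) / #|C|%:R.

(** Left unnormalised: dividing by the [r]-th power of the size of [C] gives the expectation over
    [r] uniform draws from [C]. *)
Fixpoint csample f r u : R :=
  if r is r'.+1 then \sum_(i in C) csample f r' (u + X i) else f u.

Lemma le_csample f g r u : (forall v, f v <= g v) -> csample f r u <= csample g r u.
Proof. by move=> fg; elim: r u => //= r IH u; apply: ler_sum. Qed.

Let Cn0 : #|C|%:R != 0 :> R.
Proof. by rewrite pnatr_eq0 -lt0n. Qed.

Lemma sum_center : \sum_(i in C) (X i - mean X C) = 0.
Proof.
rewrite sumrB sumr_const -scaler_nat /mean scalerA divff // scale1r.
by rewrite subrr.
Qed.

(** The cross terms vanish because the deviations from the mean sum to zero. *)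
Lemma sum_sqr_shift v :
  \sum_(i in C) enorm (v + (X i - mean X C)) ^+ 2 = #|C|%:R * (enorm v ^+ 2 + variance).
Proof.
have S0 : \sum_(i in C) dotr v (X i - mean X C) = 0.
  transitivity (dotr v (\sum_(i in C) (X i - mean X C))).
    rewrite /dotr exchange_big /=; apply: eq_bigr => j _.
    by rewrite summxE mulr_sumr.
  by rewrite sum_center /dotr big1 // => j _; rewrite mxE mulr0.
rewrite (eq_bigr (fun i => enorm v ^+ 2 + dotr v (X i - mean X C) +
    (dotr v (X i - mean X C) + enorm (X i - mean X C) ^+ 2))); last first.
  by move=> i _; rewrite !enorm_sqr dotrDl !dotrDr (dotrC (X i - _) v) !dotrDr.
rewrite !big_split /= S0 addr0 add0r sumr_const -(mulr_natl (_ ^+ 2)) mulrDr.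
by congr (_ + _); rewrite /variance mulrC divfK.
Qed.

(** Affine functions of a squared distance are closed under averaging: a draw shifts the argument by
    the mean and adds one variance. This takes the place of independence in the second moment. *)
Lemma csample_quadratic (a b : R) w r u :
  csample (fun v => a - b * enorm (v - w) ^+ 2) r u =
  #|C|%:R ^+ r * (a - b * (enorm (u + r%:R *: mean X C - w) ^+ 2 + r%:R * variance)).
Proof.
elim: r u => [|r IH] u /=; first by rewrite scale0r !mul0r !addr0 mul1r.
under eq_bigr => i _.
  rewrite IH (_ : u + X i + _ - w = (u + r.+1%:R *: mean X C - w) + (X i - mean X C)); last first.
    rewrite -[r.+1]addn1 natrD scalerDl scale1r.
    by apply/matrixP => ? ?; rewrite !mxE; ring.
  over.
rewrite -mulr_sumr sumrB sumr_const -mulr_sumr big_split /= sum_sqr_shift sumr_const.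
set Z := enorm _.
by rewrite (exprSr _ r) -(mulr_natl a) -(mulr_natl (r%:R * variance)) -natr1; ring.
Qed.

Lemma variance0 : variance = 0 -> forall i, i \in C -> X i = mean X C.
Proof.
move=> /eqP; rewrite mulf_eq0 invr_eq0 (negPf Cn0) orbF psumr_eq0 => [|i _]; last first.
  by rewrite sqr_ge0.
move=> /allP h i iC; apply/eqP; rewrite -subr_eq0; apply/eqP/dotr_eq0.
rewrite -enorm_sqr; apply/eqP.
by have /implyP/(_ iC) := h i (mem_index_enum i).
Qed.

(** Serves the case of zero variance, where the Markov threshold degenerates to 0 but every sample
    is exact. *)
Lemma csample_const f m r u : (forall i, i \in C -> X i = m) ->
  csample f r u = #|C|%:R ^+ r * f (u + r%:R *: m).
Proof.
move=> Xm; elim: r u => [|r IH] u /=; first by rewrite scale0r addr0 mul1r.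
rewrite (eq_bigr (fun=> #|C|%:R ^+ r * f (u + r.+1%:R *: m))); last first.
  move=> i /Xm ->; rewrite IH; congr (_ * f _).
  by rewrite -natr1 scalerDl scale1r (addrC (_ *: m)) addrA.
by rewrite sumr_const -[LHS]mulr_natl mulrA exprS.
Qed.

(* Markov's inequality for the squared deviation, whose expectation is r * variance. *)
Lemma csample_mean r :
  #|C|%:R ^+ r / 2 <= csample (fun u =>
    (enorm (u - r%:R *: mean X C) ^+ 2 <= 2 * (r%:R * variance))%R%:R) r 0.
Proof.
have V0 : 0 <= variance by rewrite divr_ge0 ?ler0n // sumr_ge0 // => i _; rewrite sqr_ge0.
have Cr : 0 <= #|C|%:R ^+ r :> R by rewrite exprn_ge0 ?ler0n.
have [rV|rV] := eqVneq (r%:R * variance) 0.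
  have [V|V] := eqVneq variance 0; last first.
    move: rV => /eqP; rewrite mulf_eq0 (negPf V) orbF pnatr_eq0 => /eqP -> /=.
    rewrite scale0r subr0 !mul0r mulr0 enorm_sqr /dotr big1 ?lexx.
      by rewrite expr0 /=; lra.
    by move=> j _; rewrite mxE mulr0.
  rewrite (csample_const _ _ _ (variance0 V)) add0r subrr rV mulr0.
  rewrite enorm_sqr /dotr big1 ?lexx /=; last by move=> j _; rewrite mxE mulr0.
  by rewrite mulr1; lra.
have rVp : 0 < 2 * (r%:R * variance).
  by rewrite mulr_gt0 // lt_def rV mulr_ge0 ?ler0n.
(* With t twice the expected squared deviation, the indicator of Z <= t dominates 1 - Z / t, whose
   expectation is 1/2. *)
apply: le_trans (le_csample (f := fun v =>
   1 - (2 * (r%:R * variance))^-1 * enorm (v - r%:R *: mean X C) ^+ 2) _ _ _); last first.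
  move=> v; case: (lerP (enorm _ ^+ 2)) => h /=.
    by rewrite ?mulr1n gerBl mulr_ge0 ?invr_ge0 ?sqr_ge0 // ltW.
  by rewrite subr_le0 -ler_pdivrMl ?invr_gt0 // invrK mulr1 ltW.
rewrite csample_quadratic add0r subrr enorm_sqr /dotr big1; last first.
  by move=> j _; rewrite mxE mulr0.
rewrite add0r invfM mulrAC -mulrA mulfV // mulr1 ler_wpM2l //.
lra.
Qed.

End SampleMean.

(** * Labellings and clusterings *)

Section Clusterings.
Variables (R : realType) (n d k : nat) (X : 'I_n -> 'rV[R]_d) (x : nat -> R).
Hypotheses (n0 : (0 < n)%N) (k0 : (0 < k)%N).
Hypothesis xE : forall (i : 'I_n) (j : 'I_d), x (i * d + j)%N = X i 0 j.
Implicit Types (l : nat -> nat) (C : {set 'I_n}) (P : {set {set 'I_n}}).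

(** Samples with a draw outside [C] are discarded, which only loses value as [f] is nonnegative. *)
Lemma hit_csample C (f : 'rV[R]_d -> R) r u : (forall v, 0 <= f v) ->
  csample X C f r u / n%:R ^+ r <= hit n x f r u.
Proof.
move=> f0; have hit0 : forall r v, 0 <= hit n x f r v.
  by elim=> //= r' IH v; rewrite divr_ge0 ?ler0n // sumr_ge0.
elim: r u => [|r IH] u /=; first by rewrite expr0 divr1.
rewrite exprSr invfM mulrA ler_wpM2r ?invr_ge0 ?ler0n // mulr_suml.
rewrite [leRHS](bigID (fun i => i \in C)) /= ler_wpDr ?sumr_ge0 //.
apply: ler_sum => i _; apply: le_trans (IH _) _.
rewrite le_eqVlt; apply/orP; left; apply/eqP; congr (hit _ _ _ _ (_ + _)).
by apply/matrixP => a j; rewrite ord1 mxE xE.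
Qed.

Definition block l c : {set 'I_n} := [set i : 'I_n | l i == c].

Definition label_partition l := preim_partition (fun i : 'I_n => l i) [set: 'I_n].

Lemma csizeE l c : csize l n c = #|block l c|.
Proof.
rewrite -sum1_card /csize [RHS]big_mkcond; apply: eq_bigr => i _.
by rewrite inE; case: eqP.
Qed.

Lemma cdistE l (i : 'I_n) c : cdist n d x l i c = enorm (X i - mean X (block l c)) ^+ 2.
Proof.
rewrite enorm_sqr; apply: eq_bigr => j _; rewrite -expr2 xE !mxE csizeE mulrC.
congr ((_ - _ * _) ^+ 2); rewrite summxE [RHS]big_mkcond; apply: eq_bigr => i' _.
by rewrite inE xE.
Qed.

Lemma mem_label_partition l (i : 'I_n) : block l (l i) \in label_partition l.
Proof.
apply/imsetP; exists i => //; apply/setP => i'.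
by rewrite !inE eq_sym.
Qed.

Lemma label_partitionP l A :
  reflect (exists i : 'I_n, A = block l (l i)) (A \in label_partition l).
Proof.
apply: (iffP idP) => [/imsetP[i _ ->]|[i ->]]; last exact: mem_label_partition.
by exists i; apply/setP => i'; rewrite !inE eq_sym.
Qed.

(** The blocks lie among the k sets [block l c], and nonempty ones are distinct, so there are k of
    them exactly when every label is used. *)
Lemma label_partition_full l : (forall i, (i < n)%N -> (l i < k)%N) ->
  is_clustering k (label_partition l) = [forall c : 'I_k, block l c != set0].
Proof.
move=> lk; rewrite /is_clustering preim_partitionP /=.
have sub : label_partition l \subset [set block l (c : 'I_k) | c in 'I_k].
  apply/subsetP => A /label_partitionP[i ->]; apply/imsetP.
  by exists (Ordinal (lk i (ltn_ord i))).
apply/eqP/forallP => [card c|ne].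
  have leq_im := leq_imset_card (fun c : 'I_k => block l c) 'I_k.
  have E : label_partition l = [set block l (c : 'I_k) | c in 'I_k].
    apply/eqP; rewrite eqEcard sub card; apply: leq_trans leq_im _.
    by rewrite card_ord.
  have : block l c \in label_partition l by rewrite E imset_f.
  by case/label_partitionP => i ->; apply/set0Pn; exists i; rewrite inE.
have -> : label_partition l = [set block l (c : 'I_k) | c in 'I_k].
  apply/eqP; rewrite eqEsubset sub; apply/subsetP => A /imsetP[c _ ->].
  by have /set0Pn[i] := ne c; rewrite inE => /eqP <-; apply: mem_label_partition.
rewrite card_imset ?card_ord // => c c' E.
have /set0Pn[i ic] := ne c; have := ic; rewrite E; move: ic.
by rewrite !inE => /eqP -> /eqP/val_inj.
Qed.

Lemma label_forall l (p : {set 'I_n} -> bool) : (forall i, (i < n)%N -> (l i < k)%N) ->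
  (forall c : 'I_k, block l c != set0) ->
  [forall A in label_partition l, p A] = [forall c : 'I_k, p (block l c)].
Proof.
move=> lk ne; apply/forall_inP/forallP => h.
  move=> c; apply: h; have /set0Pn[i] := ne c.
  by rewrite inE => /eqP <-; apply: mem_label_partition.
move=> A /label_partitionP[i ->].
exact: (h (Ordinal (lk i (ltn_ord i)))).
Qed.

Lemma cost_label_partition l : cost n d x l = kmeans_cost X (label_partition l).
Proof.
rewrite /cost /kmeans_cost; have /and3P[/eqP cov tI _] : partition (label_partition l) setT.
  exact: preim_partitionP.
transitivity (\sum_(i in cover (label_partition l)) cdist n d x l i (l i)).
  by rewrite cov; apply: eq_bigl => i; rewrite inE.
rewrite big_trivIset //=; apply: eq_bigr => A /label_partitionP[i0 ->].
by apply: eq_bigr => i; rewrite inE => /eqP e; rewrite cdistE e.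
Qed.

(** The program has no test that all k labels are used: the size bound omega n / k is positive and
    takes care of it. Squaring proximity is harmless for alpha >= 0. *)
Lemma valid_admissible (alpha omega : R) l : 0 <= alpha -> 0 < omega ->
  (forall i, (i < n)%N -> (l i < k)%N) ->
  valid n d k (alpha ^+ 2) (omega * n%:R / k%:R) x l =
  admissible alpha omega k X (label_partition l).
Proof.
move=> a0 o0 lk; rewrite /admissible label_partition_full //.
have proxE (i : 'I_n) c : (alpha ^+ 2 * cdist n d x l i (l i) < cdist n d x l i c) =
    (alpha * enorm (X i - mean X (block l (l i))) < enorm (X i - mean X (block l c))).
  by rewrite !cdistE -exprMn ltr_sqr ?nnegrE ?mulr_ge0 ?enorm_ge0.
rewrite /valid big_andE; under eq_forallb do rewrite big_andE.
apply/forallP/and3P => [v|[/forallP ne prox bal] i].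
  have big c : (c < k)%N -> omega * n%:R / k%:R <= #|block l c|%:R.
    move=> ck; have /forallP/(_ (Ordinal ck))/andP[+ _] := v (Ordinal n0).
    by rewrite -leNgt csizeE.
  have ne : forall c : 'I_k, block l c != set0.
    move=> c; rewrite -card_gt0 -(ltr0n R); apply: lt_le_trans (big c (ltn_ord c)).
    by rewrite divr_gt0 ?mulr_gt0 ?ltr0n.
  split; first exact/forallP.
    rewrite /center_proximal label_forall //; apply/forallP => c; rewrite label_forall //.
    apply/forallP => c'; apply/implyP => cc; apply/forall_inP => i; rewrite inE => /eqP ic.
    have /forallP/(_ c')/andP[_ /implyP] := v i.
    rewrite proxE ic; apply; apply: contraNneq cc => ->; exact: eqxx.
  by rewrite /balanced label_forall //; apply/forallP => c; apply: big.
apply/forallP => c; apply/andP; split.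
  rewrite -leNgt csizeE; move: bal; rewrite /balanced label_forall // => /forallP.
  exact.
apply/implyP => cl; rewrite proxE; move: prox; rewrite /center_proximal label_forall //.
move=> /forallP/(_ (Ordinal (lk i (ltn_ord i)))); rewrite label_forall // => /forallP/(_ c).
move=> /implyP h; have /h /forall_inP : block l (l i) != block l c.
  apply: contraNneq cl => e; have : i \in block l (l i) by rewrite inE.
  by rewrite e inE eq_sym.
by apply; rewrite inE.
Qed.

End Clusterings.

(** * A lucky trial recovers the clustering *)

Section Recovery.
Variables (R : realType) (n d k m : nat) (X : 'I_n -> 'rV[R]_d) (x : nat -> R).
Variables (alpha omega : R) (P : {set {set 'I_n}}).
Hypotheses (n0 : (0 < n)%N) (k0 : (0 < k)%N) (m0 : (0 < m)%N).
Hypothesis xE : forall (i : 'I_n) (j : 'I_d), x (i * d + j)%N = X i 0 j.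
Hypotheses (alpha1 : 1 < alpha) (omega0 : 0 < omega).
Hypothesis admP : admissible alpha omega k X P.

Let a := Num.min alpha 2.
Hypothesis m_large : 72 <= m%:R * (a - 1) ^+ 4.

(** Enumerating [P] fixes which cluster the [c]-th sampled sum is meant to hit. *)
Definition cluster c : {set 'I_n} := nth set0 (enum P) c.

Definition good_center c (u : 'rV[R]_d) : bool :=
  enorm (u - m%:R *: mean X (cluster c)) ^+ 2 <= 2 * (m%:R * variance X (cluster c)).

Let partP : partition P setT.
Proof. by have /and3P[/andP[]] := admP. Qed.

Let cardP : #|P| = k.
Proof. by have /and3P[/andP[_ /eqP]] := admP. Qed.

Lemma cluster_in c : (c < k)%N -> cluster c \in P.
Proof. by move=> ck; rewrite -mem_enum mem_nth // -cardE cardP. Qed.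

Lemma cluster_inj c c' : (c < k)%N -> (c' < k)%N -> cluster c = cluster c' -> c = c'.
Proof.
move=> ck c'k /eqP; rewrite nth_uniq ?enum_uniq -?cardE ?cardP //.
by move/eqP.
Qed.

Lemma cluster_gt0 c : (c < k)%N -> (0 < #|cluster c|)%N.
Proof.
move=> ck; rewrite card_gt0; apply: contraTneq (cluster_in ck) => ->.
by have /and3P[] := partP.
Qed.

Let a1 : 1 < a.
Proof. by rewrite lt_min alpha1 ltr1n. Qed.

Let a2 : a <= 2.
Proof. by rewrite ge_min lexx orbT. Qed.

Lemma cluster_proximal c c' i : (c < k)%N -> (c' < k)%N -> c != c' -> i \in cluster c ->
  a * enorm (X i - mean X (cluster c)) < enorm (X i - mean X (cluster c')).
Proof.
move=> ck c'k cc ic; have /and3P[_ /forall_inP/(_ _ (cluster_in ck))] := admP.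
move=> /forall_inP/(_ _ (cluster_in c'k))/implyP h _.
apply: le_lt_trans (forall_inP (h _) _ ic).
  by rewrite ler_wpM2r ?enorm_ge0 // ge_min lexx.
by apply: contraNneq cc => /(cluster_inj ck c'k) ->.
Qed.

(** The squared radius bound, averaged over the cluster, gives V (a - 1)^2 <= D^2 for the variance
    V. Hence 2 V / m <= ((a - 1) / 6)^2 D^2 once m (a - 1)^4 >= 2 * 36 = 72. *)
Lemma good_center_near c c' u : (c < k)%N -> (c' < k)%N -> c != c' -> good_center c u ->
  enorm (m%:R^-1 *: u - mean X (cluster c)) <=
    (a - 1) / 6 * enorm (mean X (cluster c) - mean X (cluster c')).
Proof.
move=> ck c'k cc; rewrite /good_center.
set mu := mean X (cluster c); set D := enorm (mu - _) => good.
have mp : 0 < m%:R :> R by rewrite ltr0n.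
have b0 : 0 < a - 1 by rewrite subr_gt0.
have D0 : 0 <= D by apply: enorm_ge0.
have cp : 0 < #|cluster c|%:R :> R by rewrite ltr0n cluster_gt0.
have var : variance X (cluster c) * (a - 1) ^+ 2 <= D ^+ 2.
  rewrite /variance mulrAC ler_pdivrMr // mulr_suml mulr_natr -sumr_const.
  apply: ler_sum => i ic; rewrite -exprMn ler_sqr ?nnegrE ?mulr_ge0 ?enorm_ge0 // ?(ltW b0) //.
  by rewrite mulrC; apply: (cluster_radius a1); apply: cluster_proximal.
move: (variance _ _) var good => V var good.
rewrite -ler_sqr ?nnegrE ?mulr_ge0 ?enorm_ge0 ?divr_ge0 ?invr_ge0 ?ler0n ?(ltW b0) //.
have -> : m%:R^-1 *: u - mu = m%:R^-1 *: (u - m%:R *: mu).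
  by rewrite scalerBr scalerA mulVf ?scale1r // gt_eqF.
rewrite enorm_sqr dotrZl dotrZr -enorm_sqr mulrA -expr2 exprVn mulrC ler_pdivrMr ?exprn_gt0 //.
apply: le_trans good _; rewrite !exprMn.
have b2 : 0 < (a - 1) ^+ 2 by rewrite exprn_gt0.
rewrite -(ler_pM2r b2); apply: (@le_trans _ _ (2 * m%:R * D ^+ 2)).
  by rewrite -!mulrA ler_pM2l // ler_pM2l.
have h : 0 <= (m%:R * (a - 1) ^+ 4 - 72) * (m%:R * D ^+ 2) / 36.
  by rewrite divr_ge0 // mulr_ge0 ?subr_ge0 // mulr_ge0 ?sqr_ge0 // ltW.
by rewrite -subr_ge0; move: h; congr (0 <= _); field.
Qed.

Lemma label_partition_recovered (S : nat -> 'rV[R]_d) l :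
  (forall c, (c < k)%N -> good_center c (S c)) ->
  (forall i, (i < n)%N -> (l i < k)%N /\
    forall c, (c < k)%N -> rowdist m x i (S (l i)) <= rowdist m x i (S c)) ->
  label_partition n l = P.
Proof.
move=> good near.
have rowE (i : 'I_n) u : rowdist m x i u = enorm (X i - m%:R^-1 *: u) ^+ 2.
  by rewrite enorm_sqr; apply: eq_bigr => j _; rewrite xE !mxE expr2 [u _ _ / _]mulrC.
(* A wrong label [l i] would lose: both centres are accurate relative to the distance of these two
   means, so [c] is strictly closer. The wrong label itself supplies the second cluster, so k = 1 is
   no special case. *)
have own (i : 'I_n) c : (c < k)%N -> i \in cluster c -> l i = c.
  move=> ck ic; have [lk le] := near i (ltn_ord i); apply/eqP; apply: contraT => lc.
  have := le c ck; rewrite !rowE ler_sqr ?nnegrE ?enorm_ge0 // leNgt.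
  rewrite (nearest_center (mA := mean X (cluster c)) (mB := mean X (cluster (l i))) a1 a2) //.
  - by apply: cluster_proximal; rewrite // eq_sym.
  - by apply: good_center_near; rewrite ?good // eq_sym.
  - by rewrite (enormBC (mean X (cluster c))); apply: good_center_near; rewrite ?good.
have cov (i : 'I_n) : i \in cover P by have /and3P[/eqP-> _ _] := partP; rewrite inE.
have tI : trivIset P by have /and3P[] := partP.
have lE (i : 'I_n) : cluster (l i) = pblock P i.
  have bP : pblock P i \in enum P by rewrite mem_enum pblock_mem.
  have ck : (index (pblock P i) (enum P) < k)%N by rewrite -cardP cardE index_mem.
  have cE : cluster (index (pblock P i) (enum P)) = pblock P i by rewrite /cluster nth_index.
  by rewrite (own i _ ck) // cE mem_pblock.
rewrite -[RHS](equivalence_partition_pblock partP); apply: eq_imset => i.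
apply/setP => i'; rewrite !inE /= -eq_pblock // -!lE.
apply/eqP/eqP => [->//|]; apply: cluster_inj.
  by have [] := near i (ltn_ord i).
by have [] := near i' (ltn_ord i').
Qed.

Lemma good_center_prob c : (c < k)%N ->
  (omega / k%:R) ^+ m / 2 <= hit n x (fun u => (good_center c u)%:R) m 0.
Proof.
move=> ck; apply: le_trans (hit_csample xE (cluster c) m 0 _); last first.
  by move=> u; rewrite ler0n.
apply: (@le_trans _ _ (#|cluster c|%:R ^+ m / 2 / n%:R ^+ m)); last first.
  rewrite ler_wpM2r ?invr_ge0 ?exprn_ge0 ?ler0n //.
  by apply: csample_mean; apply: cluster_gt0.
rewrite mulrAC -expr_div_n ler_wpM2r ?invr_ge0 // lerXn2r ?nnegrE ?divr_ge0 ?ler0n ?(ltW omega0) //.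
rewrite ler_pdivlMr ?ltr0n // mulrAC.
by have /and3P[_ _ /forall_inP/(_ _ (cluster_in ck))] := admP.
Qed.

End Recovery.

Lemma nth_allpairs (S T U : Type) (f : S -> T -> U) s t (s0 : S) (t0 : T) (u0 : U) i j :
  (i < size s)%N -> (j < size t)%N ->
  nth u0 [seq f y z | y <- s, z <- t] (i * size t + j) = f (nth s0 s i) (nth t0 t j).
Proof.
move=> si tj; elim: s i si => [//|y s IH] [|i] si /=; rewrite nth_cat size_map.
  by rewrite mul0n add0n tj (nth_map t0).
by rewrite mulSn -addnA ltnNge leq_addr /= addKn IH.
Qed.

Lemma input_coord (R : realType) n d k (X : 'I_n -> 'rV[R]_d) (i : 'I_n) (j : 'I_d) :
  rmem (input k X) (i * d + j)%N = X i 0 j.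
Proof.
have E := @nth_allpairs _ _ _ (fun i j => X i 0 j) (enum 'I_n) (enum 'I_d) i j 0 i j.
move: E; rewrite !size_enum_ord => /(_ (ltn_ord i) (ltn_ord j)) /=.
by rewrite !nth_ord_enum => ->.
Qed.

Lemma halt_prob_le1 (R : realType) T ps (s : state R) E : halt_prob T ps s E <= 1.
Proof.
elim: T ps s => [|T IH] [|p ps] s //=; try by rewrite lern1 leq_b1.
case: p => [|o|a b|p q|c p q|c p] //=.
(* An aborting draw has probability x / 0 = 0. *)
have [->|b0] := eqVneq (nreg s b) 0%N; first by rewrite invr0 mulr0.
rewrite ler_pdivrMr ?ltr0n ?lt0n // mul1r.
by rewrite -[X in _ <= X%:R]card_ord -sumr_const; apply: ler_sum.
Qed.

(** Summing the k size bounds gives omega n <= n. *)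
Lemma no_admissible (R : realType) (alpha omega : R) n d k (X : 'I_n -> 'rV[R]_d) P :
  (0 < n)%N -> (0 < k)%N -> admissible alpha omega k X P -> omega <= 1.
Proof.
move=> n0 k0 /and3P[/andP[pP /eqP cP] _ /forall_inP bal].
have : \sum_(C in P) (omega * n%:R / k%:R) <= (\sum_(C in P) #|C|)%:R :> R.
  by rewrite natr_sum; apply: ler_sum.
rewrite -(card_partition pP) cardsT card_ord sumr_const cP -[leLHS]mulr_natr divfK.
  by rewrite ger_pMl ?ltr0n.
by rewrite pnatr_eq0 -lt0n.
Qed.

(** Since (1 - q)^N (1 + q)^N <= 1, Bernoulli's inequality (1 + q)^N >= 1 + q N >= 2 bounds the
    failure probability by 1/2. *)
Lemma repeated_trials (R : realType) (q : R) N : 0 <= q <= 1 -> 1 <= q * N%:R ->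
  1 / 2 <= 1 - (1 - q) ^+ N.
Proof.
move=> /andP[q0 q1] qN.
have bern : 1 + q * N%:R <= (1 + q) ^+ N.
  elim: {qN} N => [|N IH]; first by rewrite mulr0 addr0 expr0.
  rewrite exprS; apply: le_trans (ler_wpM2l _ IH); last by lra.
  have : 0 <= q * q * N%:R by rewrite !mulr_ge0 ?ler0n.
  rewrite -natr1; lra.
have h1 : (1 - q) ^+ N * (1 + q) ^+ N <= 1.
  by rewrite -exprMn exprn_ile1 //; nra.
have h0 : 0 <= (1 - q) ^+ N by rewrite exprn_ge0 // subr_ge0.
have : (1 - q) ^+ N * 2 <= (1 - q) ^+ N * (1 + q) ^+ N by rewrite ler_wpM2l //; lra.
lra.
Qed.

(** * Correctness and running time *)

Section Algorithm.
Variables (R : realType) (n d k m W : nat) (alpha omega : R) (X : 'I_n -> 'rV[R]_d).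
Hypotheses (n0 : (0 < n)%N) (d0 : (0 < d)%N) (k0 : (0 < k)%N) (W0 : (0 < W)%N).

Let x := rmem (input k X).
Let xE : forall (i : 'I_n) (j : 'I_d), x (i * d + j)%N = X i 0 j := input_coord k X.

Definition trials := ((2 * (W * k) ^ m) ^ k)%N.

Definition run_time := (2000 * (trials * (k * m.+1) * (n * d)))%N.

Let trials_gt0 : (0 < trials)%N.
Proof. by rewrite expn_gt0 muln_gt0 expn_gt0 muln_gt0 W0 k0. Qed.

(** Sure termination is the degenerate instance of [main_spec] with no good sums, q = 0 and constant
    value 1; it holds whether or not an admissible clustering exists. *)
Lemma main_halts :
  halt_prob run_time [:: main_code m W (alpha ^+ 2) omega] (input k X) xpredT = 1.
Proof.
apply/le_anti; rewrite halt_prob_le1 /=.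
have hit0 r (u : 'rV[R]_d) : 0 <= hit n x (fun=> false%:R) r u :> R.
  by elim: r u => [|r IH] u //=; rewrite divr_ge0 ?ler0n // sumr_ge0.
have := @main_spec R n d k m trials (alpha ^+ 2) (omega * n%:R / k%:R) x n0 d0 k0
  0 (fun _ _ => false) 0 (lexx _) ler01 (fun c _ => hit0 m 0).
move=> /(_ _ (input k X) W omega 1 0 erefl trials_gt0 erefl erefl erefl erefl).
rewrite !mul0r addr0 /trip => /(_ _ _ _ 0%N [::] xpredT); rewrite addn0; apply => //.
- by move=> S l /(_ 0%N k0).
- by move=> s' _; rewrite mul0r addr0.
Qed.

Hypotheses (alpha1 : 1 < alpha) (omega0 : 0 < omega) (omega1 : omega <= 1).
Hypotheses (m0 : (0 < m)%N) (m_large : 72 <= m%:R * (Num.min alpha 2 - 1) ^+ 4).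
Hypothesis W_large : 1 <= omega * W%:R.

Lemma main_succeeds : (exists P, admissible alpha omega k X P) ->
  1 / 2 <= halt_prob run_time [:: main_code m W (alpha ^+ 2) omega] (input k X)
    (fun s => optimal alpha omega k X (output n s)).
Proof.
case=> P0 admP0.
have [P admP minP] := @arg_minP _ _ _ P0 (fun P => admissible alpha omega k X P)
  (kmeans_cost X) admP0.
pose q := (omega / k%:R) ^+ m / 2.
have ok0 : 0 <= omega / k%:R by rewrite divr_ge0 ?ler0n // ltW.
have okm1 : (omega / k%:R) ^+ m <= 1.
  rewrite exprn_ile1 // ler_pdivrMr ?ltr0n // mul1r (le_trans omega1) //.
  by rewrite -[leLHS]/(1%:R) ler_nat.
have okm0 : 0 <= (omega / k%:R) ^+ m by rewrite exprn_ge0.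
have q0 : 0 <= q by rewrite divr_ge0.
have q1 : q <= 1 by rewrite /q; lra.
have alpha0 : 0 <= alpha by rewrite ltW // (lt_trans ltr01).
(* The product telescopes to (omega W)^(m k). *)
have qN : 1 <= q ^+ k * trials%:R.
  rewrite /trials natrX -exprMn exprn_ege1 // natrM natrX natrM /q.
  rewrite -mulrA [2^-1 * _]mulrA mulVf ?pnatr_eq0 // mul1r -exprMn exprn_ege1 //.
  by rewrite mulrA mulrAC divfK // pnatr_eq0 -lt0n.
have validE l : (forall i, (i < n)%N -> (l i < k)%N) ->
    valid n d k (alpha ^+ 2) (omega * n%:R / k%:R) x l =
    admissible alpha omega k X (label_partition n l).
  exact: valid_admissible.
have costE l : cost n d x l = kmeans_cost X (label_partition n l).
  exact: cost_label_partition.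
have rec := label_partition_recovered m0 xE alpha1 admP m_large.
have := @main_spec R n d k m trials (alpha ^+ 2) (omega * n%:R / k%:R) x n0 d0 k0
  (kmeans_cost X P) (good_center m X P) q q0 q1.
move=> /(_ _ _ (input k X) W omega 0 1 erefl trials_gt0 erefl erefl erefl erefl).
rewrite add0r mul1r => h; apply: le_trans (repeated_trials _ qN) _.
  by rewrite exprn_ge0 //= exprn_ile1.
rewrite -[run_time]addn0; apply: h => //.
- by move=> c ck; apply: (good_center_prob m n0 xE omega0 admP).
- move=> S l good near; have lk i : (i < n)%N -> (l i < k)%N by case/near.
  by rewrite validE // costE (rec S l good near) admP lexx.
(* Only [found] states count; there the stored labels are valid and cost at most as much as the
   minimiser [P]. *)
move=> s' bs' /=; rewrite add0r mul1r; case f: (found _ s') => //=.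
move: f; rewrite /found; case: bs' => [-> //|[-> [l [vl lE ->]]]] /= cl.
have lk i : (i < n)%N -> (l i < k)%N by case/lE.
have outE : output n s' = label_partition n l.
  apply: eq_imset => i; apply/setP => i'; rewrite !inE.
  by rewrite (lE i _).1 // (lE i' _).1.
rewrite outE /optimal -validE // vl /= -costE.
suff -> : [forall Q, admissible alpha omega k X Q ==> (cost n d x l <= kmeans_cost X Q)].
  by rewrite lexx.
apply/forallP => Q; apply/implyP => admQ; exact: le_trans (minP Q admQ).
Qed.

(** The wasteful bound r < 2^r is applied to W k, k and m, since only a polynomial exponent is aimed
    at. *)
Lemma run_time_exp :
  (run_time <= 2000 * 2 ^ (k * (1 + m * (W * k)) + k + m) * (n * d))%N.
Proof.
rewrite /run_time mulnA leq_mul2r; apply/orP; right.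
rewrite leq_mul2l /= !expnD -mulnA; apply: leq_mul; last first.
  by apply: leq_mul; [exact/ltnW/ltn_expl | exact: ltn_expl].
rewrite /trials [X in (_ <= 2 ^ X)%N]mulnC expnM leq_exp2r // expnD leq_mul2l /=.
rewrite [X in (_ <= 2 ^ X)%N]mulnC expnM leq_exp2r //.
exact/ltnW/ltn_expl.
Qed.

End Algorithm.

(* y = k / (omega (a - 1)) dominates k, W k / 2 and (m / 73)^(1/4), so the
   exponent is at most 221 y^7; and y <= alpha z for z = k / (omega (alpha - 1))
   gives y^7 <= alpha^7 z^7 <= alpha^14 + z^14. *)
Lemma exponent_bound (R : realType) (k m W : nat) (alpha omega : R) :
  (0 < k)%N -> 1 < alpha -> 0 < omega -> omega <= 1 ->
  m%:R * (Num.min alpha 2 - 1) ^+ 4 <= 73 -> W%:R * omega <= 2 ->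
  (k * (1 + m * (W * k)) + k + m)%:R <=
    221 * alpha ^+ 14 + 221 * (k%:R / (omega * (alpha - 1))) ^+ 14 :> R.
Proof.
move=> k0 alpha1 o0 o1; set a := Num.min alpha 2 => mB WB.
have a1 : 1 < a by rewrite lt_min alpha1 ltr1n.
have a2 : a <= 2 by rewrite ge_min lexx orbT.
have b0 : 0 < a - 1 by rewrite subr_gt0.
have kp : 1 <= k%:R :> R by rewrite ler1n.
set z := k%:R / (omega * (alpha - 1)).
set y := k%:R / (omega * (a - 1)).
have oa : 0 < omega * (a - 1) by rewrite mulr_gt0.
have oal : 0 < omega * (alpha - 1) by rewrite mulr_gt0 // subr_gt0.
have oa1 : omega * (a - 1) <= 1 by rewrite mulr_ile1 ?(ltW o0) ?(ltW b0) //; lra.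
have z0 : 0 <= z by rewrite divr_ge0 ?ler0n // ltW.
have ky : k%:R <= y by rewrite ler_pdivlMr // ler_piMr ?ler0n.
have y1 : 1 <= y by apply: le_trans ky.
have by1 : 1 <= (a - 1) * y.
  have -> : (a - 1) * y = k%:R / omega by rewrite /y; field; rewrite !gt_eqF.
  by rewrite ler_pdivlMr // mul1r (le_trans o1).
have y0 : 0 <= y by apply: le_trans y1.
have Wky : W%:R * k%:R <= 2 * y.
  rewrite /y mulrA ler_pdivlMr // mulrACA ler_pM ?mulr_ge0 ?ler0n ?(ltW o0) ?(ltW b0) //.
  by rewrite ler_piMr ?ler0n //; lra.
have my : m%:R <= 73 * y ^+ 4.
  apply: (@le_trans _ _ (m%:R * ((a - 1) * y) ^+ 4)).
    by rewrite ler_peMr ?ler0n // exprn_ege1.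
  by rewrite exprMn mulrA ler_wpM2r // exprn_ge0.
have yz : y <= alpha * z.
  have [al2|al2] := leP alpha 2.
    have <- : y = z by rewrite /y /z /a (min_idPl al2).
    by rewrite ler_peMl // ltW.
  have -> : y = (alpha - 1) * z.
    rewrite /y /z /a (min_idPr (ltW al2)); field.
    by rewrite !gt_eqF // ?subr_gt0.
  by rewrite ler_wpM2r // gerBl.
have y7 : y ^+ 7 <= alpha ^+ 14 + z ^+ 14.
  have al0 : 0 <= alpha by rewrite ltW // (lt_trans ltr01).
  apply: (@le_trans _ _ (alpha ^+ 7 * z ^+ 7)).
    by rewrite -exprMn lerXn2r ?nnegrE //; apply: mulr_ge0.
  rewrite -[14%N]/(7 * 2)%N !exprM.
  have := sqr_ge0 (alpha ^+ 7 - z ^+ 7); rewrite sqrrB.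
  have : 0 <= alpha ^+ 7 * z ^+ 7 by rewrite mulr_ge0 ?exprn_ge0.
  rewrite mulr2n; lra.
have yX i : (i <= 7)%N -> y ^+ i <= y ^+ 7 by move=> i7; rewrite ler_weXn2l.
have mWk : m%:R * (W%:R * k%:R) <= 146 * y ^+ 5.
  apply: le_trans (ler_pM _ _ my Wky) _; rewrite ?mulr_ge0 ?ler0n //.
  by rewrite le_eqVlt; apply/orP; left; apply/eqP; ring.
have kmWk : k%:R * (m%:R * (W%:R * k%:R)) <= 146 * y ^+ 6.
  apply: le_trans (ler_pM _ _ ky mWk) _; rewrite ?mulr_ge0 ?ler0n //.
  by rewrite le_eqVlt; apply/orP; left; apply/eqP; ring.
(* The exponent is at most 2 y + 146 y^6 + 73 y^4, and 2 + 146 + 73 = 221. *)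
rewrite !natrD natrM natrD !natrM mulrDr mulr1.
have := yX 1%N isT; have := yX 4%N isT; have := yX 6%N isT; rewrite expr1; lra.
Qed.

Theorem theorem1 (R : realType) :
  exists (p : {poly R}) (K : R -> R) (p0 : R),
    {homo K : x y / x <= y} /\ 0 < p0 /\
    forall alpha omega : R, 1 < alpha -> 0 < omega ->
    exists A : program R,
    forall (n d k : nat) (X : 'I_n -> 'rV[R]_d),
      (0 < n)%N -> (0 < d)%N -> (0 < k)%N -> injective X ->
    exists T : nat,
      T%:R <= K alpha * 2 `^ p.[k%:R / (omega * (alpha - 1))] * (n * d)%:R /\
      halt_prob T [:: A] (input k X) xpredT = 1 /\
      ((exists P : {set {set 'I_n}}, admissible alpha omega k X P) ->
       p0 <= halt_prob T [:: A] (input k X)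
               (fun s => optimal alpha omega k X (output n s))).
Proof.
have two1 : 1 <= 2 :> R by rewrite ler1n.
(* The factor depending on alpha is there because k / (omega (alpha - 1)) tends to 0 as alpha grows,
   whereas the program is equally slow from alpha = 2 on. The maximum with 0 makes that factor
   monotone on negative arguments too. *)
exists (221%:P * 'X^14), (fun a => 2000 * 2 `^ (221 * Num.max a 0 ^+ 14)), (1 / 2).
split.
  move=> a b ab; have mab : Num.max a 0 <= Num.max b 0.
    by rewrite ge_max !le_max ab lexx orbT.
  have ma : 0 <= Num.max a 0 by rewrite le_max lexx orbT.
  by rewrite ler_pM2l // ler_powR // ler_pM2l // lerXn2r ?nnegrE // (le_trans ma).
split=> [|alpha omega alpha1 omega0]; first by rewrite divr_gt0.
have alpha0 : 0 <= alpha by rewrite ltW // (lt_trans ltr01).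
have maxE : Num.max alpha 0 = alpha by apply/max_idPl.
have [omega1|omega1] := leP omega 1; last first.
  exists (Skip R) => n d k X n0 d0 k0 _; exists 1%N; split; last first.
    by split=> // -[P /(no_admissible n0 k0)]; rewrite leNgt omega1.
  rewrite hornerM hornerC hornerXn.
  rewrite -[leLHS]mul1r ler_pM // ?ler1n ?muln_gt0 ?n0 //.
  rewrite -[leLHS]mulr1 ler_pM // ?mulr_ge0 ?powR_ge0 //.
  - rewrite -[leLHS]mulr1 ler_pM // ?ler1n // -{1}(powRr0 2) ler_powR //.
    by rewrite mulr_ge0 ?exprn_ge0 ?le_max ?lexx ?orbT.
  - rewrite -[leLHS](powRr0 2) ler_powR // mulr_ge0 // exprn_ge0 // divr_ge0 //.
    by rewrite mulr_ge0 ?(ltW omega0) // subr_ge0 ltW.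
set a := Num.min alpha 2.
have a1 : 1 < a by rewrite lt_min alpha1 ltr1n.
have a2 : a <= 2 by rewrite ge_min lexx orbT.
have b0 : 0 < (a - 1) ^+ 4 by rewrite exprn_gt0 // subr_gt0.
have b1 : (a - 1) ^+ 4 <= 1 by rewrite exprn_ile1 //; lra.
(* Both successors are positive, bound 72 / (a - 1)^4 and 1 / omega from above, and exceed them by
   at most 1; hence the 73 and the 2 in [exponent_bound]. *)
pose m := (Num.truncn (72 / (a - 1) ^+ 4)).+1.
pose W := (Num.truncn omega^-1).+1.
have /andP[m_le m_gt] := truncn_itv (divr_ge0 (ler0n R 72) (ltW b0)).
have oi0 : 0 <= omega^-1 by rewrite invr_ge0 ltW.
have /andP[W_le W_gt] := truncn_itv oi0.
exists (main_code m W (alpha ^+ 2) omega) => n d k X n0 d0 k0 _.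
exists (run_time n d k m W); split; last split.
- apply: (@le_trans _ _ (2000 * 2 ^ (k * (1 + m * (W * k)) + k + m) * (n * d))%:R).
    by rewrite ler_nat run_time_exp.
  rewrite [leLHS]natrM ler_wpM2r ?ler0n // natrM -mulrA ler_pM2l // maxE.
  rewrite hornerM hornerC hornerXn natrX -powR_mulrn // -powRD ?pnatr_eq0 ?implybT //.
  rewrite ler_powR // exponent_bound //.
  + rewrite -/a /m -natr1 mulrDl mul1r.
    by rewrite ler_pdivlMr // in m_le; lra.
  + rewrite /W -natr1 mulrDl mul1r.
    have : (Num.truncn omega^-1)%:R * omega <= 1 by rewrite -ler_pdivlMr // div1r.
    lra.
- exact: main_halts.
- apply: main_succeeds => //.
  + by rewrite -ler_pdivrMr // ltW.
  + by rewrite mulrC -ler_pdivrMr // div1r ltW.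
Qed.
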